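(* In dimension $d=3$ there is a number $\eta>0$ and a constant $K>0$ such that for all integers $n\ge 1$ and all real coefficients $\alpha(R)$, indexed by the dyadic rectangles $R\subset[0,1]^3$ with $|R|=2^{-n}$, $$2^{-n}\sum_{|R|=2^{-n}}|\alpha(R)|\le K\, n^{1-\eta}\,\Bigl\|\sum_{|R|=2^{-n}}\alpha(R)\,h_R\Bigr\|_{L^\infty([0,1]^3)} .$$
   Context: The dyadic intervals are $\mathcal D=\{[j2^{-k},(j+1)2^{-k}) : k\ge 0,\ 0\le j\le 2^k-1\}$ ($j,k$ integers). For $I\in\mathcal D$ the ($L^\infty$-normalized) Haar function is $h_I=-\mathbf 1_{I_{\mathrm{left}}}+\mathbf 1_{I_{\mathrm{right}}}$, where $I_{\mathrm{left}},I_{\mathrm{right}}$ are the left and right halves of $I$. A dyadic rectangle in the unit cube $[0,1]^3$ is a product $R=R_1\times R_2\times R_3$ with $R_j\in\mathcal D$; $|R|$ is its volume; and $h_R(x_1,x_2,x_3)=\prod_{j=1}^3h_{R_j}(x_j)$. Sums over $|R|=2^{-n}$ run over all dyadic rectangles of volume $2^{-n}$. *)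

(* Defs.v *)
From HB Require Import structures.
From mathcomp Require Import all_boot all_order all_algebra.
From mathcomp Require Import all_classical all_reals all_analysis.

Set Implicit Arguments.
Unset Strict Implicit.
Unset Printing Implicit Defensive.

Import Order.TTheory GRing.Theory Num.Theory.
Import numFieldNormedType.Exports.

Local Open Scope classical_set_scope.
Local Open Scope ring_scope.

(* The pair (k, j), with j < 2 ^ k, encodes [j 2^-k, (j + 1) 2^-k). *)
Definition dyadic : Type := {k : nat & 'I_(2 ^ k)}.

Definition dyadic_rect : Type := (dyadic * dyadic * dyadic)%type.

(* [measurableTypeR R] is [R] with the sigma-algebra on which
   [lebesgue_measure] is defined. *)
Notation R3 R :=
  (measurableTypeR R * measurableTypeR R * measurableTypeR R)%type.

Section dyadic_sets.
Context {R : realType}.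
Implicit Types (I : dyadic) (r : dyadic_rect).

Definition dyadic_lo I : R := (tagged I)%:R * 2 ^- tag I.
Definition dyadic_hi I : R := (tagged I).+1%:R * 2 ^- tag I.
Definition dyadic_mid I : R := (dyadic_lo I + dyadic_hi I) / 2.

Definition dyadic_itv I : set R := `[dyadic_lo I, dyadic_hi I[.
Definition dyadic_left I : set R := `[dyadic_lo I, dyadic_mid I[.
Definition dyadic_right I : set R := `[dyadic_mid I, dyadic_hi I[.

Definition dyadic_box r : set (R3 R) :=
  dyadic_itv r.1.1 `*` dyadic_itv r.1.2 `*` dyadic_itv r.2.

Definition haar I (x : R) : R :=
  - \1_(dyadic_left I) x + \1_(dyadic_right I) x.

Definition haar_rect r (x : R3 R) : R :=
  haar r.1.1 x.1.1 * haar r.1.2 x.1.2 * haar r.2 x.2.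

Definition unit_cube : set (R3 R) := `[0, 1] `*` `[0, 1] `*` `[0, 1].

Lemma measurable_unit_cube : measurable unit_cube.
Proof. by apply: measurableX => //; exact: measurableX. Qed.

End dyadic_sets.
Arguments dyadic_lo : clear implicits.
Arguments dyadic_hi : clear implicits.
Arguments dyadic_mid : clear implicits.
Arguments dyadic_itv : clear implicits.
Arguments dyadic_box : clear implicits.
Arguments unit_cube : clear implicits.

Section small_ball.
Variable R : realType.

Definition lebesgue_measure3 : {measure set (R3 R) -> \bar R} :=
  ((lebesgue_measure \x lebesgue_measure) \x lebesgue_measure)%E.

Definition unit_cube_measure : {measure set (R3 R) -> \bar R} :=
  mrestr lebesgue_measure3 measurable_unit_cube.

Definition dyadic_rects (n : nat) : set dyadic_rect :=
  [set r | lebesgue_measure3 (dyadic_box R r) = (2 ^- n)%:E].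

Lemma lebesgue_measure_dyadic_itv (I : dyadic) :
  lebesgue_measure (dyadic_itv R I) = (2 ^- tag I)%:E.
Proof.
rewrite /dyadic_itv lebesgue_measure_itv/= lte_fin /dyadic_lo /dyadic_hi.
rewrite ltr_pM2r ?invr_gt0 ?exprn_gt0// ltr_nat ltnSn -EFinB.
by rewrite -mulrBl -natrB// subSnn mul1r.
Qed.

Lemma dyadic_rectsE n :
  dyadic_rects n = [set r | (tag r.1.1 + tag r.1.2 + tag r.2)%N = n].
Proof.
have vol r : lebesgue_measure3 (dyadic_box R r) =
    (2 ^- (tag r.1.1 + tag r.1.2 + tag r.2))%:E.
  have mI (I : dyadic) :
      measurable (dyadic_itv R I : set (measurableTypeR R)).
    exact: measurable_itv.
  rewrite [LHS]product_measure1E//; last exact: measurableX.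
  rewrite [X in (X * _)%E]product_measure1E//= !lebesgue_measure_dyadic_itv -!EFinM.
  by rewrite !exprD !invfM.
apply/seteqP; split => r /=; rewrite /dyadic_rects/= vol; last by move=> ->.
by move=> [] /invr_inj; apply: ieexprIn; rewrite ?pnatr_eq1.
Qed.

(* The finitely supported sums over [dyadic_rects n] are thus true sums. *)
Lemma finite_dyadic_rects n : finite_set (dyadic_rects n).
Proof.
rewrite dyadic_rectsE.
pose A : set dyadic := \bigcup_(k in `I_n.+1)
  (fun j => Tagged (fun k => 'I_(2 ^ k)) j) @` [set: 'I_(2 ^ k)].
have finA : finite_set A.
  apply: bigcup_finite => [|k _]; first exact: finite_II.
  exact/finite_image/finite_finset.
apply: (@sub_finite_set _ _ (A `*` A `*` A)); last first.
  by apply: finite_setX => //; exact: finite_setX.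
have AI (I : dyadic) : (tag I <= n)%N -> A I.
  by case: I => k j /= kn; exists k => //=; exists j.
move=> r /= rn; split; first split; apply: AI; rewrite -rn.
- by rewrite -addnA leq_addr.
- by rewrite addnAC leq_addl.
- by rewrite leq_addl.
Qed.

End small_ball.

(* Main.v *)
(* By duality one needs, for all signs, a function of bounded L^1 norm whose
   coefficient at each signed h_R with |R| = 2^-n is n^(-1+eta). Let f_r, for
   r_1 + r_2 + r_3 = n, be the signed sum of the h_R of level r. Cut the levels
   r_1 into q blocks, q a small power of n, and let F_t be the sum of the f_r
   over block t. The test function Psi is the part of prod_t (1 + rho F_t),
   rho = n^(-1+eta), made of the products of f_r's no two of which share a level
   in some coordinate (Bilyk-Lacey). In each coordinate the finest level of such
   a product occurs once, so the nonlinear ones are orthogonal to every h_R with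
   |R| = 2^-n.

   To bound the L^1 norm, let Psi_t(X, Z) collect the products from the first t
   blocks that avoid the levels X and use all the levels Z of the second and
   third coordinates. Then Psi_{t+1}(X, Z) - (1 + rho F_t) Psi_t(X, Z) is a
   martingale sum in the digits of the first coordinate, whose quadratic
   variation is controlled by the bounds on Psi_t. Azuma's inequality and a
   union bound over (X, Z) give |Psi_t(X, Z)| <= C lam^|Z| prod_{s<t} |1 + rho F_s|
   with lam close to n^(-1/2), outside an event so rare that a trivial bound
   suffices there. The product has bounded mean, since by Azuma's inequality
   again 1 + rho F_s is positive with overwhelming conditional probability. *)

Require Import Defs.
From mathcomp Require Import all_boot all_order all_algebra.
From mathcomp Require Import all_classical all_reals all_analysis.
From mathcomp Require Import ring lra zify.

Import Order.TTheory GRing.Theory Num.Theory.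
Import numFieldNormedType.Exports.

Local Open Scope ring_scope.

Set Implicit Arguments.
Unset Strict Implicit.
Unset Printing Implicit Defensive.

(** * Digits and Azuma's inequality *)

(** Cutting into blocks is what allows [rho] to exceed [N^-1]. A block of [N / q] levels has about
    [N^2 / q] summands, so its signed sum is typically of size [N / sqrt q], and the trivial
    [rho = N^-1] can be beaten by a power of [q]. The obstacle is that products with a shared level
    need not be orthogonal to the [h_R], while removing them destroys the product structure, and
    with it the positivity that gives the L^1 norm of a Riesz product. The correction made at block
    [t] involves only products forbidden to use the levels of the new factor. Avoidance is turned
    into use by inclusion and exclusion, so the recursion must carry both sets [X] and [Z]. A level
    forced in advance leaves about [N] factors through it; square root cancellation in their sum
    gives [rho * sqrt N], which is why [lam] is near [N^-1/2]. All functions depend on the digits of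
    levels 0 to [n] only, so everything before the essential supremum takes place on a finite
    probability space. *)

Section DigitCube.
Variables (R : realType) (N : nat).

(* The first [N] binary digits of the three coordinates of a point. *)
Definition cube := {ffun 'I_3 * 'I_N -> bool}.
Implicit Types (w : cube) (c : 'I_3) (g h W : cube -> R).

Definition flip (p : 'I_3 * 'I_N) w : cube :=
  [ffun x => if x == p then ~~ w x else w x].

Lemma flipK p : involutive (flip p).
Proof.
move=> w; apply/ffunP => x; rewrite !ffunE.
by case: eqP => // _; rewrite negbK.
Qed.

Definition mean g : R := (#|{: cube}|%:R)^-1 * \sum_w g w.

Lemma card_cube_gt0 : 0 < #|{: cube}|%:R :> R.
Proof. by rewrite ltr0n; apply/card_gt0P; exists [ffun=> true]. Qed.

Lemma eq_mean g h : g =1 h -> mean g = mean h.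
Proof. by move=> e; congr (_ * _); apply: eq_bigr => w _. Qed.

Lemma mean_cst (a : R) : mean (fun=> a) = a.
Proof.
rewrite /mean sumr_const -[a *+ _]mulr_natr mulrCA mulVf ?mulr1//.
by rewrite gt_eqF// card_cube_gt0.
Qed.

Lemma meanD g h : mean (fun w => g w + h w) = mean g + mean h.
Proof. by rewrite /mean big_split mulrDr. Qed.

Lemma meanZ a g : mean (fun w => a * g w) = a * mean g.
Proof. by rewrite /mean -mulr_sumr mulrCA. Qed.

Lemma mean_sum (I : Type) (r : seq I) (P : pred I) (F : I -> cube -> R) :
  mean (fun w => \sum_(i <- r | P i) F i w) = \sum_(i <- r | P i) mean (F i).
Proof. by rewrite /mean exchange_big mulr_sumr. Qed.

Lemma ler_mean g h : (forall w, g w <= h w) -> mean g <= mean h.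
Proof.
move=> le; rewrite ler_wpM2l ?invr_ge0//.
by apply: ler_sum => w _.
Qed.

Lemma mean_ge0 g : (forall w, 0 <= g w) -> 0 <= mean g.
Proof. by move=> g0; rewrite mulr_ge0 ?invr_ge0//; apply: sumr_ge0. Qed.

Lemma mean_flip p g : mean (fun w => g (flip p w)) = mean g.
Proof.
rewrite /mean; congr (_ * _).
by rewrite [RHS](reindex_inj (inv_inj (flipK p))).
Qed.

Lemma mean_sym p g : mean g = mean (fun w => 2^-1 * (g w + g (flip p w))).
Proof. by rewrite meanZ meanD mean_flip; lra. Qed.

Definition inv c (i : nat) g :=
  forall (j : 'I_N) w, (i <= j)%N -> g (flip (c, j) w) = g w.

(* A sum of functions that are fresh at distinct levels [i] of one coordinate
   is a martingale with respect to the digits of that coordinate. *)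
Definition fresh c (i : 'I_N) g :=
  (forall w, g (flip (c, i) w) = - g w) /\ inv c i.+1 g.

Lemma inv_cst c i a : inv c i (fun=> a). Proof. by []. Qed.

Lemma inv_le c i j g : (i <= j)%N -> inv c i g -> inv c j g.
Proof. by move=> ij gi k w jk; apply: gi; apply: leq_trans jk. Qed.

Lemma inv1 c i g (F : R -> R) : inv c i g -> inv c i (fun w => F (g w)).
Proof. by move=> gi j w ij; rewrite gi. Qed.

Lemma inv2 c i g h (F : R -> R -> R) : inv c i g -> inv c i h ->
  inv c i (fun w => F (g w) (h w)).
Proof. by move=> gi hi j w ij; rewrite gi ?hi. Qed.

Lemma inv_sum c i (I : Type) (r : seq I) (P : pred I) (F : I -> cube -> R) :
  (forall k, P k -> inv c i (F k)) -> inv c i (fun w => \sum_(k <- r | P k) F k w).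
Proof. by move=> Fi j w ij; apply: eq_bigr => k Pk; apply: Fi. Qed.

Lemma inv_prod c i (I : Type) (r : seq I) (P : pred I) (F : I -> cube -> R) :
  (forall k, P k -> inv c i (F k)) -> inv c i (fun w => \prod_(k <- r | P k) F k w).
Proof. by move=> Fi j w ij; apply: eq_bigr => k Pk; apply: Fi. Qed.

Lemma fresh_inv c i g : fresh c i g -> inv c i.+1 g.
Proof. by case. Qed.

Lemma fresh0 c i : fresh c i (fun=> 0).
Proof. by split => // w; rewrite oppr0. Qed.

Lemma fresh_mul c i g h : fresh c i g -> inv c i h -> fresh c i (fun w => g w * h w).
Proof.
move=> [gi gi'] hi; split => [w|j w ij]; first by rewrite gi hi// mulNr.
by rewrite gi' ?hi// ltnW.
Qed.

Lemma fresh_sum c i (I : Type) (r : seq I) (P : pred I) (F : I -> cube -> R) :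
  (forall k, P k -> fresh c i (F k)) ->
  fresh c i (fun w => \sum_(k <- r | P k) F k w).
Proof.
move=> Fi; split => [w|].
  by rewrite -sumrN; apply: eq_bigr => k /Fi[->].
by apply: inv_sum => k /Fi[].
Qed.

Lemma eq_fresh c i g h : g =1 h -> fresh c i g -> fresh c i h.
Proof. by move=> e [g1 g2]; split => [w|j w ij]; rewrite -!e ?g1 ?g2. Qed.

Lemma mean_odd p g : (forall w, g (flip p w) = - g w) -> mean g = 0.
Proof.
move=> gi; apply/eqP; rewrite -[_ == _](mulrn_eq0 _ 2) mulr2n.
rewrite -[X in X + _](mean_flip p) -meanD; apply/eqP.
by rewrite -[RHS](mean_cst 0); apply: eq_mean => w; rewrite gi addNr.
Qed.

(** With 2 instead of the optimal 1/2, [1 + x <= expR x] suffices: it bounds [expR y] by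
    [1 / (1 - y)] and [expR (- y)] by [1 / (1 + y)] when [y <= 1/2], and for larger [y] one has
    [y <= 2 * y ^+ 2]. *)
Lemma cosh_le (y : R) : (expR y + expR (- y)) / 2 <= expR (2 * y ^+ 2).
Proof.
wlog y0 : y / 0 <= y.
  move=> H; have [/H//|/ltW y0] := leP 0 y.
  by have := H (- y); rewrite oppr_ge0 opprK sqrrN addrC; apply.
have [y2|y2] := leP y (1 / 2).
  have e1 : expR (- y) >= 1 - y by exact: expR_ge1Dx.
  have e0 : 0 < expR (- y) by exact: expR_gt0.
  have e2 : expR y * expR (- y) = 1 by rewrite -expRD subrr expR0.
  have e5 : expR (- y) * (1 + y) <= 1.
    by rewrite -[X in _ <= X]e2 mulrC ler_pM2r// expR_ge1Dx.
  have e3 : expR y <= 1 + y + 2 * y ^+ 2.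
    rewrite -(ler_pM2r e0) e2.
    have : 1 <= (1 + y + 2 * y ^+ 2) * (1 - y) by nra.
    move/le_trans; apply; rewrite ler_wpM2l//; nra.
  have e4 : expR (- y) <= 1 - y + 2 * y ^+ 2.
    have : expR (- y) * (1 + y) <= (1 - y + 2 * y ^+ 2) * (1 + y) by nra.
    by rewrite ler_pM2r//; lra.
  apply: (@le_trans _ _ (1 + 2 * y ^+ 2)); first lra.
  exact: expR_ge1Dx.
apply: (@le_trans _ _ (expR y)).
  have : expR (- y) <= expR y by rewrite ler_expR; lra.
  lra.
by rewrite ler_expR; nra.
Qed.

Section Azuma.
Variables (c : 'I_3) (P : pred 'I_N) (Y : 'I_N -> cube -> R) (W : cube -> R).
Hypotheses (Y_fresh : forall i, P i -> fresh c i (Y i))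
  (W_ge0 : forall w, 0 <= W w)
  (W_inv : forall i w, P i -> W (flip (c, i) w) = W w).

(** [Y i] changes sign with the digit [i], so its square does not depend on that digit and is
    predictable. Averaging over the digit produces a hyperbolic cosine, which [cosh_le] cancels
    against the compensator. Thus the true sum of squares may stand in the exponent, without any
    bound on the single [Y i]. *)
Lemma mean_exp_azuma (x : R) :
  mean (fun w => W w * expR (x * \sum_(i | P i) Y i w -
                             2 * x ^+ 2 * \sum_(i | P i) Y i w ^+ 2)) <= mean W.
Proof.
pose S k w : R := \sum_(i < N | P i && (i < k)%N) Y i w.
pose V k w : R := \sum_(i < N | P i && (i < k)%N) Y i w ^+ 2.
pose G k w := W w * expR (x * S k w - 2 * x ^+ 2 * V k w).
suff H k : (k <= N)%N -> mean (G k) <= mean W.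
  apply: le_trans (H N (leqnn _)); rewrite le_eqVlt; apply/orP; left; apply/eqP.
  apply: eq_mean => w; rewrite /G /S /V; do 2 f_equal.
  by congr (_ * _ - _ * _); apply: eq_bigl => i; rewrite ltn_ord andbT.
elim: k => [|k IH] kN.
  rewrite le_eqVlt; apply/orP; left; apply/eqP; apply: eq_mean => w.
  rewrite /G /S /V !big_pred0 ?mulr0 ?subrr ?expR0 ?mulr1//;
  by move=> i; rewrite ltn0 andbF.
apply: le_trans (IH (ltnW kN)).
pose i0 := Ordinal kN.
have SE (F : 'I_N -> R) : \sum_(i < N | P i && (i < k.+1)%N) F i =
    (if P i0 then F i0 else 0) + \sum_(i < N | P i && (i < k)%N) F i.
  case: ifPn => Pi0.
    rewrite (bigD1 i0) ?Pi0//=; congr (_ + _); apply: eq_bigl => i.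
    rewrite -(inj_eq val_inj)/= -andbA; congr (_ && _).
    by rewrite ltnS ltn_neqAle andbC.
  rewrite add0r; apply: eq_bigl => i.
  case: (boolP (P i)) => //= Pi; rewrite ltnS leq_eqVlt.
  case: eqP => //= ik; move: Pi0; rewrite (_ : i0 = i) ?Pi//.
  exact/val_inj.
case: (boolP (P i0)) => Pi0; last first.
  rewrite le_eqVlt; apply/orP; left; apply/eqP; apply: eq_mean => w.
  by rewrite /G /S /V !SE (negbTE Pi0) !add0r.
have inv_lt (i : 'I_N) w : P i && (i < k)%N -> Y i (flip (c, i0) w) = Y i w.
  by move=> /andP[Pi ik]; case: (Y_fresh Pi) => _; apply.
have Sf w : S k (flip (c, i0) w) = S k w.
  by apply: eq_bigr => i; apply: inv_lt.
have Vf w : V k (flip (c, i0) w) = V k w.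
  by apply: eq_bigr => i /inv_lt->.
rewrite (mean_sym (c, i0)); apply: ler_mean => w.
have Sk v : S k.+1 v = Y i0 v + S k v by rewrite /S SE Pi0.
have Vk v : V k.+1 v = Y i0 v ^+ 2 + V k v by rewrite /V (SE (fun i => Y i v ^+ 2)) Pi0.
rewrite /G !Sk !Vk Sf Vf (W_inv _ Pi0) (Y_fresh Pi0).1 sqrrN.
have -> : 2^-1 * (W w * expR (x * (Y i0 w + S k w) - 2 * x ^+ 2 * (Y i0 w ^+ 2 + V k w)) +
  W w * expR (x * (- Y i0 w + S k w) - 2 * x ^+ 2 * (Y i0 w ^+ 2 + V k w))) =
  W w * expR (x * S k w - 2 * x ^+ 2 * V k w) *
   ((expR (x * Y i0 w) + expR (- (x * Y i0 w))) / 2 * expR (- (2 * (x * Y i0 w) ^+ 2))).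
  have -> : x * (Y i0 w + S k w) - 2 * x ^+ 2 * (Y i0 w ^+ 2 + V k w) =
    (x * S k w - 2 * x ^+ 2 * V k w) + x * Y i0 w + (- (2 * (x * Y i0 w) ^+ 2)) by ring.
  have -> : x * (- Y i0 w + S k w) - 2 * x ^+ 2 * (Y i0 w ^+ 2 + V k w) =
    (x * S k w - 2 * x ^+ 2 * V k w) + (- (x * Y i0 w)) + (- (2 * (x * Y i0 w) ^+ 2)) by ring.
  rewrite !expRD; ring.
rewrite -[leRHS]mulr1 ler_wpM2l ?mulr_ge0 ?expR_ge0//.
apply: (@le_trans _ _ (expR (2 * (x * Y i0 w) ^+ 2) * expR (- (2 * (x * Y i0 w) ^+ 2)))).
  by rewrite ler_wpM2r ?expR_ge0 ?cosh_le.
by rewrite -expRD subrr expR0.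
Qed.

(** Chernoff's bound for both signs, with [x = m / (4 * V)] minimizing [2 * x ^+ 2 * V - x * m]. The
    weight [W] makes the bound conditional on the earlier blocks. *)
Lemma mean_azuma (V m : R) : 0 < V -> 0 <= m ->
  mean (fun w => W w * ((m < `|\sum_(i | P i) Y i w|) &&
                        (\sum_(i | P i) Y i w ^+ 2 <= V))%:R)
    <= 2 * mean W * expR (- (m ^+ 2 / (8 * V))).
Proof.
move=> V0 m0.
pose S w := \sum_(i | P i) Y i w; pose U w := \sum_(i | P i) Y i w ^+ 2.
pose x := m / (4 * V).
pose g y w := W w * expR (y * S w - 2 * y ^+ 2 * U w).
have x0 : 0 <= x by rewrite divr_ge0// mulr_ge0// ltW.
have ex : x * m - 2 * x ^+ 2 * V = m ^+ 2 / (8 * V).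
  rewrite /x; field; exact: lt0r_neq0.
apply: (@le_trans _ _ (mean (fun w => expR (- (m ^+ 2 / (8 * V))) * (g x w + g (- x) w)))).
  apply: ler_mean => w.
  have g0 y : 0 <= g y w by rewrite mulr_ge0// expR_ge0.
  case: (boolP (_ && _)) => [/andP[mS UV]|_]; last first.
    by rewrite mulr0 mulr_ge0 ?expR_ge0 ?addr_ge0.
  rewrite mulr1 -(@ler_pM2l _ (expR (m ^+ 2 / (8 * V)))) ?expR_gt0//.
  rewrite mulrA -expRD subrr expR0 mul1r mulrC.
  have key y : y ^+ 2 = x ^+ 2 -> x * m <= y * S w -> W w * expR (m ^+ 2 / (8 * V)) <= g y w.
    move=> yx xm; rewrite ler_wpM2l// ler_expR -ex yx lerB//.
    by rewrite ler_wpM2l// mulr_ge0// sqr_ge0.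
  have [S0|S0] := leP 0 (S w).
    rewrite -[leLHS]addr0 lerD//; apply: key => //; rewrite ler_wpM2l//.
    by rewrite ltW// (lt_le_trans mS)// ger0_norm.
  rewrite -[leLHS]add0r lerD//; apply: key; first by rewrite sqrrN.
  rewrite mulNr -mulrN ler_wpM2l//.
  by rewrite ltW// (lt_le_trans mS)// ltr0_norm.
rewrite meanZ meanD mulrC ler_wpM2r ?expR_ge0//.
have := mean_exp_azuma x; have := mean_exp_azuma (- x).
rewrite /g /S /U; lra.
Qed.

End Azuma.

End DigitCube.

(** * Finite sums and almost orthogonality *)

Section FiniteSums.
Variable R : realType.

(** The support condition leaves at most one nonzero term: with [i + j + k = n], two levels
    determine the third. *)
Lemma sum_unique (n B : nat) (P : pred 'I_n.+1) (F : 'I_n.+1 -> R) (b : R) :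
  0 <= b -> (forall x, F x != 0 -> (x + B = n)%N) -> (forall x, `|F x| <= b) ->
  `|\sum_(x | P x) F x| <= b.
Proof.
move=> b0 FB Fb; case: (pickP (fun x => P x && (F x != 0))) => [x /andP[Px Fx]|F0].
  rewrite (bigD1 x)//= big1 ?addr0// => y /andP[_ yx].
  apply/eqP/negP => /negP/FB yB; move/eqP: yx; apply; apply/val_inj => /=.
  by have := FB _ Fx; lia.
rewrite big1 ?normr0// => x Px; apply/eqP; apply/negP => /negP Fx.
by have := F0 x; rewrite Px Fx.
Qed.

Lemma sum_norm_unique (n B : nat) (P : pred 'I_n.+1) (F : 'I_n.+1 -> R) (b : R) :
  0 <= b -> (forall x, F x != 0 -> (x + B = n)%N) -> (forall x, `|F x| <= b) ->
  \sum_(x | P x) `|F x| <= b.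
Proof.
move=> b0 FB Fb; rewrite -[leLHS]ger0_norm ?sumr_ge0//.
apply: sum_unique (b0) _ _ => x; first by rewrite normr_eq0; apply: FB.
by rewrite normr_id.
Qed.

(** The square is expanded and the sum over [b] taken inside; the coefficients [x a] need only a
    uniform bound because they do not depend on [b]. *)
Lemma quad_le (A B : finType) (PA : pred A) (PB : pred B) (x : A -> R)
    (h : A -> B -> R) (X p d : R) : 0 <= p -> 0 <= d ->
  (forall a, `|x a| <= X) ->
  (forall a a', a != a' -> `|\sum_(b | PB b) h a b * h a' b| <= p) ->
  (forall a, \sum_(b | PB b) h a b ^+ 2 <= d) ->
  \sum_(b | PB b) (\sum_(a | PA a) x a * h a b) ^+ 2 <=
    X ^+ 2 * (#|PA|%:R ^+ 2 * p + #|PA|%:R * d).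
Proof.
move=> p0 d0 xX hp hd.
have X2 a a' : `|x a * x a'| <= X ^+ 2 by rewrite normrM expr2 ler_pM.
have -> : \sum_(b | PB b) (\sum_(a | PA a) x a * h a b) ^+ 2 =
    \sum_(a | PA a) \sum_(a' | PA a') x a * x a' * (\sum_(b | PB b) h a b * h a' b).
  under eq_bigr do rewrite expr2 big_distrlr/=.
  rewrite exchange_big/=; apply: eq_bigr => a _.
  rewrite exchange_big/=; apply: eq_bigr => a' _.
  by rewrite mulr_sumr; apply: eq_bigr => b _; rewrite mulrACA.
apply: (@le_trans _ _ (\sum_(a | PA a) \sum_(a' | PA a') (X ^+ 2 * p + (a == a')%:R * (X ^+ 2 * d)))).
  apply: ler_sum => a _; apply: ler_sum => a' _.
  apply: le_trans (ler_norm _) _; rewrite normrM.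
  have [->|aa'] := eqVneq a a'.
    rewrite mul1r -mulrDr ler_pM//.
    rewrite ger0_norm; first by apply: le_trans (hd a') _; rewrite lerDr.
    by apply: sumr_ge0 => b _; rewrite -expr2 sqr_ge0.
  by rewrite mul0r addr0 ler_pM// hp.
under eq_bigr => a Pa do rewrite big_split/= sumr_const.
rewrite big_split/= sumr_const.
have -> : \sum_(a | PA a) (\sum_(a' | PA a') (a == a')%:R * (X ^+ 2 * d)) =
   #|PA|%:R * (X ^+ 2 * d).
  under eq_bigr => a Pa.
    rewrite (bigD1 a)//= eqxx mul1r big1 ?addr0; last first.
      by move=> a' /andP[_ /negbTE]; rewrite eq_sym => ->; rewrite mul0r.
    over.
  by rewrite sumr_const mulr_natl.
have -> : X ^+ 2 * p *+ #|PA| *+ #|PA| = X ^+ 2 * p * #|PA|%:R * #|PA|%:R.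
  by rewrite !mulr_natr.
lra.
Qed.

Lemma sqr_sum_lt (n : nat) (x : 'I_n -> R) :
  (\sum_a x a) ^+ 2 =
  \sum_a x a ^+ 2 + 2 * \sum_a x a * \sum_(a' < n | (a' < a)%N) x a'.
Proof.
rewrite expr2 big_distrlr/=.
have -> : \sum_a \sum_b x a * x b = \sum_a (x a ^+ 2 +
    \sum_(b < n | (b < a)%N) x a * x b + \sum_(b < n | (a < b)%N) x a * x b).
  apply: eq_bigr => a _; rewrite (bigD1 a)//= -expr2 -addrA; congr (_ + _).
  rewrite (bigID (fun b : 'I_n => (b < a)%N))/=; congr (_ + _); apply: eq_bigl => b;
  by rewrite -(inj_eq val_inj)/=; case: ltngtP.
rewrite !big_split/= -addrA; congr (_ + _).
rewrite mulr_natl mulr2n; congr (_ + _).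
  by apply: eq_bigr => a _; rewrite mulr_sumr.
rewrite (exchange_big_dep xpredT)//=; apply: eq_bigr => a _.
by rewrite mulr_sumr; apply: eq_bigr => b _; rewrite mulrC.
Qed.

End FiniteSums.

Lemma card_div (n l t : nat) : (0 < l)%N -> (#|[pred x : 'I_n | x %/ l == t]| <= l)%N.
Proof.
move=> l0; rewrite -[leqRHS]card_ord.
pose g (x : 'I_n) := Ordinal (ltn_pmod x l0).
rewrite -(@card_in_image _ _ g [pred x : 'I_n | x %/ l == t]%N) ?max_card//.
move=> x y; rewrite !inE => /eqP xt /eqP yt [] xy; apply/val_inj => /=.
by rewrite (divn_eq x l) (divn_eq y l) xt yt xy.
Qed.

(** * Union bound and tails of correlations *)

Section Probability.
Variables (R : realType) (N : nat).
Implicit Types A B : cube N -> bool.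

Definition prob A : R := mean (fun w => (A w)%:R).

Lemma prob_sub A B : (forall w, A w -> B w) -> prob A <= prob B.
Proof.
by move=> AB; apply: ler_mean => w; case: (A w) (AB w) => [->|_]; rewrite ?ler0n.
Qed.

Lemma prob_or A B : prob (fun w => A w || B w) <= prob A + prob B.
Proof.
rewrite -meanD; apply: ler_mean => w.
by case: (A w); case: (B w); rewrite /= ?addr0 ?add0r ?lerDl.
Qed.

Lemma prob_exists (I : finType) (P : pred I) (A : I -> cube N -> bool) (p : R) :
  0 <= p -> (forall i, P i -> prob (A i) <= p) ->
  prob (fun w => [exists i, P i && A i w]) <= #|P|%:R * p.
Proof.
move=> p0 Ap; apply: (@le_trans _ _ (\sum_(i | P i) prob (A i))); last first.
  by apply: le_trans (ler_sum _ Ap) _; rewrite sumr_const mulr_natl.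
rewrite -mean_sum; apply: ler_mean => w.
case: existsP => [[i /andP[Pi Ai]]|_]; last by rewrite sumr_ge0.
by rewrite (bigD1 i)//= Ai lerDl sumr_ge0.
Qed.

End Probability.
Arguments prob {R N} A.
Arguments prob_or {R N} A B.

Lemma azuma_tail (R : realType) (N : nat) (c : 'I_3) (P : pred 'I_N)
    (Y : 'I_N -> cube N -> R) (V dl : R) : 0 < V -> 0 <= dl ->
  (forall i, P i -> fresh c i (Y i)) ->
  prob (fun w => (dl * Num.sqrt V < `|\sum_(i | P i) Y i w|) &&
                 (\sum_(i | P i) Y i w ^+ 2 <= V)) <= 2 * expR (- (dl ^+ 2 / 8)) :> R.
Proof.
move=> V0 dl0 Yfr.
have m0 : 0 <= dl * Num.sqrt V by rewrite mulr_ge0// sqrtr_ge0.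
have := @mean_azuma R N c P Y (fun=> 1) Yfr (fun=> ler01)
  (fun _ _ _ => erefl) V (dl * Num.sqrt V) V0 m0.
rewrite mean_cst mulr1.
have -> : (dl * Num.sqrt V) ^+ 2 / (8 * V) = dl ^+ 2 / 8.
  by rewrite exprMn sqr_sqrtr ?ltW// invfM mulrACA divff ?mulr1// gt_eqF.
by apply: le_trans; apply: ler_mean => w; rewrite mul1r.
Qed.

(* The supports force the [u] factor of each product to have the finer level,
   so the products are martingale differences although the levels of [x] agree. *)
Section PairTail.
Variables (R : realType) (n : nat) (c : 'I_3).
Local Notation N := n.+1.

Lemma pair_tail (P : pred 'I_N) (u u' : 'I_N -> 'I_N -> cube N -> R)
    (A A' : nat) (V dl : R) : (A < A')%N -> 0 < V -> 0 <= dl -> #|P|%:R <= V ->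
  (forall x k, fresh c k (u x k)) -> (forall x (k : 'I_N), inv c k.+1 (u' x k)) ->
  (forall x (k : 'I_N) w, u x k w != 0 -> (x + A + k = n)%N) ->
  (forall x (k : 'I_N) w, u' x k w != 0 -> (x + A' + k = n)%N) ->
  (forall x k w, `|u x k w| <= 1) -> (forall x k w, `|u' x k w| <= 1) ->
  prob (fun w => dl * Num.sqrt V <
     `|\sum_(x | P x) (\sum_k u x k w) * (\sum_k u' x k w)|)
  <= 2 * expR (- (dl ^+ 2 / 8)) :> R.
Proof.
move=> AA' V0 dl0 PV u_fr u'_inv u_s u'_s u1 u'1.
pose Y k w := \sum_(x | P x) \sum_k' u x k w * u' x k' w.
have YE w : \sum_(x | P x) (\sum_k u x k w) * (\sum_k u' x k w) = \sum_(k | true) Y k w.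
  rewrite [RHS]exchange_big/=; apply: eq_bigr => x _.
  by rewrite big_distrlr.
have Yfr k : fresh c k (Y k).
  apply: fresh_sum => x _; apply: fresh_sum => k' _.
  have [kk'|kk'] := ltnP k' k.
    by apply: fresh_mul => //; apply: inv_le (u'_inv x k').
  apply: (eq_fresh _ (fresh0 _ c k)) => w; apply/esym/eqP; apply/negPn/negP.
  rewrite mulf_eq0 negb_or => /andP[/u_s + /u'_s].
  by lia.
have su' x w : `|\sum_k u' x k w| <= 1.
  by apply: (@sum_unique _ _ (x + A')) => // k /u'_s; rewrite addnC.
have YF k w : Y k w = \sum_(x | P x) u x k w * \sum_k' u' x k' w.
  by apply: eq_bigr => x _; rewrite mulr_sumr.
have F1 x k w : `|u x k w * \sum_k' u' x k' w| <= `|u x k w|.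
  by rewrite normrM ler_piMr.
have Y1 k w : `|Y k w| <= 1.
  rewrite YF; apply: (@sum_unique _ _ (A + k)) => // x.
    by rewrite mulf_eq0 negb_or => /andP[/u_s + _]; rewrite addnA.
  exact: le_trans (F1 _ _ _) _.
(* For given [k] only one [x] contributes, so [|Y k| <= 1] and the square is at most [|Y k|];
   exchanging the sums then leaves at most 1 for each [x]. *)
have YV w : \sum_(k | true) Y k w ^+ 2 <= V.
  apply: le_trans PV; apply: (@le_trans _ _ (\sum_k \sum_(x | P x) `|u x k w|)).
    apply: ler_sum => k _; rewrite -real_normK ?num_real// expr2.
    apply: (@le_trans _ _ `|Y k w|); first by rewrite ler_piMr.
    rewrite YF; apply: le_trans (ler_norm_sum _ _ _) _.
    by apply: ler_sum => x _; apply: F1.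
  rewrite exchange_big/= -sumr_const; apply: ler_sum => x _.
  apply: (@sum_norm_unique _ _ (x + A)) => // k /u_s.
  by rewrite addnC.
apply: le_trans (@azuma_tail R N c xpredT Y V dl V0 dl0 (fun i _ => Yfr i)).
by apply: prob_sub => w; rewrite YE YV andbT.
Qed.

End PairTail.

Definition c0 : 'I_3 := @Ordinal 3 0 isT.
Definition c1 : 'I_3 := @Ordinal 3 1 isT.
Definition c2 : 'I_3 := @Ordinal 3 2 isT.

(* [f i j k] stands for a signed sum of the [h_R] with [R] of side lengths
   [2 ^- i], [2 ^- j], [2 ^- k]; it vanishes unless [i + j + k = n]. *)
Record haar_family (R : realType) (n : nat)
    (f : 'I_n.+1 -> 'I_n.+1 -> 'I_n.+1 -> cube n.+1 -> R) : Prop := HaarFamily {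
  fam_supp : forall i j k w, f i j k w != 0 -> (i + j + k = n)%N;
  fam_le1 : forall i j k w, `|f i j k w| <= 1;
  fam_fresh0 : forall i j k, fresh c0 i (f i j k);
  fam_fresh1 : forall i j k, fresh c1 j (f i j k);
  fam_fresh2 : forall i j k, fresh c2 k (f i j k) }.

(** * Second moment of a block *)

(* The off-diagonal terms [Y a] of the square form a martingale in the second
   coordinate. To bound its quadratic variation, [part] is split into [head],
   constant on the blocks of [l] consecutive [a], on which the rows [rowf i]
   and [rowf i'] are almost orthogonal, and at most [l] further terms. *)
Section BlockSecondMoment.
Variables (R : realType) (n : nat).
Local Notation N := n.+1.
Variable f : 'I_N -> 'I_N -> 'I_N -> cube N -> R.
Hypothesis hf : haar_family f.

Definition rowf i j w : R := \sum_k f i j k w.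

Lemma rowf_le1 i j w : `|rowf i j w| <= 1.
Proof.
apply: (@sum_unique _ _ (i + j)) => // k; last exact: fam_le1.
by move/(fam_supp hf); rewrite addnC.
Qed.

Lemma rowf_sqr_le1 i j w : rowf i j w ^+ 2 <= 1.
Proof. by rewrite -real_normK ?num_real// expr_le1// rowf_le1. Qed.

Lemma rowf_fresh i j : fresh c1 j (rowf i j).
Proof. by apply: fresh_sum => k _; apply: fam_fresh1. Qed.

Variables (I : pred 'I_N) (b l : nat) (dl : R).
Hypotheses (cardI : (#|I| <= b)%N) (l_gt0 : (0 < l)%N) (lN : (l <= N)%N)
  (dl_ge1 : 1 <= dl) (width_large : 12 * dl ^+ 4 <= b%:R)
  (scale_large : 12 * dl ^+ 5 <= Num.sqrt l%:R) (scale_small : 6 * l%:R ^+ 2 * dl ^+ 2 <= N%:R).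

Let head i (j : nat) w : R := \sum_(a < N | (a %/ l < j)%N) rowf i a w.
Let part i (a : 'I_N) w : R := \sum_(a' < N | (a' < a)%N) rowf i a' w.
Let Y (a : 'I_N) w : R := \sum_(i | I i) rowf i a w * part i a w.

Let dl0 : 0 < dl. Proof. exact: lt_le_trans dl_ge1. Qed.

Let Y_fresh a : fresh c1 a (Y a).
Proof.
apply: fresh_sum => i _; apply: fresh_mul; first exact: rowf_fresh.
by apply: inv_sum => a' a'a; apply: inv_le (fresh_inv (rowf_fresh i a')).
Qed.

Let head_bad w := [exists p : 'I_N * 'I_N, true &&
  (dl * Num.sqrt N%:R < `|head p.1 p.2 w|)].

Let pair_bad w := [exists p : 'I_N * 'I_N * 'I_N, (p.1.2 < p.1.1)%N &&
  (dl * Num.sqrt l%:R < `|\sum_(a < N | (a %/ l == p.2)%N)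
     rowf p.1.2 a w * rowf p.1.1 a w|)].

(** Chosen to make [dl * Num.sqrt Vmart] equal to [N * b], the size allowed for the off-diagonal
    sum. *)
Let Vmart : R := (N%:R * b%:R / dl) ^+ 2.

Let mart_bad w := (N%:R * b%:R < `|\sum_a Y a w|) && (\sum_a Y a w ^+ 2 <= Vmart).

Let eps : R := 2 * expR (- (dl ^+ 2 / 8)).

Let eps_ge0 : 0 <= eps. Proof. by rewrite mulr_ge0 ?expR_ge0. Qed.

Let prob_head : prob head_bad <= N%:R ^+ 2 * eps.
Proof.
apply: le_trans (prob_exists eps_ge0 _) _ => [[i j] _|] /=; last first.
  by rewrite cardT -cardE card_prod card_ord natrM expr2.
apply: le_trans (@azuma_tail R N c1 (fun a => a %/ l < j)%N (rowf i) N%:R dl _ _ _) => //.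
- apply: prob_sub => w H; apply/andP; split => //.
  apply: le_trans (ler_sum _ (fun a _ => rowf_sqr_le1 i a w)) _.
  by rewrite sumr_const ler_nat -[leqRHS]card_ord max_card.
- exact: ltW.
- by move=> a _; apply: rowf_fresh.
Qed.

(** A martingale in the third coordinate: at a common second level, the row with the smaller first
    level has the finer third level. *)
Let prob_pair : prob pair_bad <= N%:R ^+ 3 * eps.
Proof.
apply: le_trans (prob_exists eps_ge0 _) _ => [[[i i'] j] /= ii'|] /=; last first.
  rewrite ler_wpM2r//; apply: (@le_trans _ _ #|{: 'I_N * 'I_N * 'I_N}|%:R).
    by rewrite ler_nat max_card.
  by rewrite !card_prod card_ord !natrM !exprS expr0 mulr1 mulrA.
rewrite /rowf; apply: (@pair_tail R n c2 (fun a => a %/ l == j)%N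
  (fun a k => f i' a k) (fun a k => f i a k) i' i) => //.
- by rewrite ltr0n.
- exact: ltW.
- by rewrite ler_nat card_div.
- by move=> x k; apply: fam_fresh2.
- by move=> x k; apply: fresh_inv; apply: fam_fresh2.
- by move=> x k w /(fam_supp hf); rewrite (addnC x).
- by move=> x k w /(fam_supp hf); rewrite (addnC x).
- by move=> x k w; apply: fam_le1.
- by move=> x k w; apply: fam_le1.
Qed.

Let b_gt0 : 0 < b%:R :> R.
Proof. apply: lt_le_trans width_large; by rewrite mulr_gt0// exprn_gt0. Qed.

Let Vmart_gt0 : 0 < Vmart.
Proof. by rewrite exprn_gt0// divr_gt0// mulr_gt0// ltr0n. Qed.

Let prob_mart : prob mart_bad <= eps.
Proof.
have -> : prob mart_bad = prob (fun w => (dl * Num.sqrt Vmart < `|\sum_(a | true) Y a w|) &&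
    (\sum_(a | true) Y a w ^+ 2 <= Vmart)) :> R.
  apply: eq_mean => w; rewrite /mart_bad.
  have -> // : dl * Num.sqrt Vmart = N%:R * b%:R.
  rewrite sqrtr_sqr ger0_norm; last by rewrite divr_ge0 ?mulr_ge0// ltW.
  by rewrite mulrC divfK// gt_eqF.
by apply: azuma_tail => //; exact: ltW.
Qed.

Let quad_bound w : ~~ head_bad w -> ~~ pair_bad w -> \sum_a Y a w ^+ 2 <= Vmart.
Proof.
move=> /existsPn hh /existsPn hp.
have head_le i (j : 'I_N) : `|head i j w| <= dl * Num.sqrt N%:R.
  by have := hh (i, j); rewrite /= -leNgt.
have pair_le i i' (j : 'I_N) : i != i' ->
    `|\sum_(a < N | (a %/ l == j)%N) rowf i a w * rowf i' a w| <= dl * Num.sqrt l%:R.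
  rewrite -(inj_eq val_inj)/=; case: ltngtP => // ii' _.
    have := hp (i', i, j); rewrite /= ii'/= -leNgt//.
  have := hp (i, i', j); rewrite /= ii'/= -leNgt//.
  by under eq_bigr do rewrite mulrC.
have jN (a : 'I_N) : (a %/ l < N)%N by rewrite (leq_ltn_trans (leq_div _ _)).
pose J a := Ordinal (jN a).
pose main a := \sum_(i | I i) head i (J a) w * rowf i a w.
have Yle a : Y a w ^+ 2 <= 2 * main a ^+ 2 + 2 * (b%:R * l%:R) ^+ 2.
  have -> : Y a w = main a + \sum_(i | I i) rowf i a w *
      \sum_(a' < N | (a' < a)%N && (a' %/ l == J a)%N) rowf i a' w.
    rewrite -big_split/=; apply: eq_bigr => i _.
    rewrite [head _ _ _ * _]mulrC -mulrDr; congr (_ * _).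
    rewrite /part (bigID (fun a' : 'I_N => (a' %/ l < J a)%N))/=; congr (_ + _).
      apply: eq_bigl => a'; rewrite andbC; case: (ltnP (a' %/ l) _) => //= h.
      rewrite ltnNge; apply/negP => h2; move: h; by rewrite ltnNge (@leq_div2r l a a' h2).
    apply: eq_bigl => a'; case: (ltnP a' a) => //= h.
    by rewrite -leqNgt eqn_leq (@leq_div2r l a' a (ltnW h)).
  set r := \sum_(i | I i) _.
  have rle : `|r| <= b%:R * l%:R.
    apply: le_trans (ler_norm_sum _ _ _) _.
    apply: (@le_trans _ _ (\sum_(i | I i) l%:R)); last first.
      by rewrite sumr_const -[leLHS]mulr_natl ler_wpM2r// ler_nat.
    apply: ler_sum => i _; rewrite normrM -[leRHS]mul1r ler_pM// ?rowf_le1//.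
    apply: le_trans (ler_norm_sum _ _ _) _.
    apply: (@le_trans _ _ (\sum_(a' < N | (a' < a)%N && (a' %/ l == J a)%N) 1)).
      by apply: ler_sum => a' _; apply: rowf_le1.
    rewrite sumr_const ler_nat; apply: leq_trans (@card_div N l (J a) l_gt0).
    by apply/subset_leq_card/fintype.subsetP => x /andP[].
  have r2 : r ^+ 2 <= (b%:R * l%:R) ^+ 2.
    by rewrite -real_normK ?num_real// lerXn2r ?nnegrE// mulr_ge0.
  have := sqr_ge0 (main a - r); nra.
have mainE : \sum_a main a ^+ 2 <= (n %/ l).+1%:R *
    ((dl * Num.sqrt N%:R) ^+ 2 * (b%:R ^+ 2 * (dl * Num.sqrt l%:R) + b%:R * l%:R)).
  have p0 (a : 'I_N) : true -> (a %/ l < (n %/ l).+1)%N.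
    by move=> _; rewrite ltnS leq_div2r// -ltnS.
  rewrite (partition_big (fun a : 'I_N => inord (a %/ l) : 'I_(n %/ l).+1) xpredT)//=.
  apply: (@le_trans _ _ (\sum_(j < (n %/ l).+1) ((dl * Num.sqrt N%:R) ^+ 2 *
      (b%:R ^+ 2 * (dl * Num.sqrt l%:R) + b%:R * l%:R)))); last first.
    by rewrite sumr_const card_ord -[leLHS]mulr_natl.
  apply: ler_sum => j _.
  have jN' : (j < N)%N by apply: leq_trans (ltn_ord j) _; rewrite ltnS leq_div.
  pose j' := Ordinal jN'.
  have -> : \sum_(a < N | inord (a %/ l) == j) main a ^+ 2 =
     \sum_(a < N | (a %/ l == j')%N) (\sum_(i | I i) head i j' w * rowf i a w) ^+ 2.
    apply: eq_big => a.
      by rewrite -(inj_eq val_inj)/= inordK ?p0.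
    move=> /eqP ja; congr (_ ^+ 2); apply: eq_bigr => i _; congr (head _ _ _ * _).
    by rewrite /= -ja inordK ?p0.
  have sl0 : 0 <= dl * Num.sqrt l%:R by rewrite mulr_ge0 ?sqrtr_ge0// ltW.
  apply: le_trans (@quad_le R _ _ I (fun a : 'I_N => a %/ l == j')%N
     (fun i => head i j' w) (fun i a => rowf i a w) (dl * Num.sqrt N%:R)
     (dl * Num.sqrt l%:R) l%:R sl0 _ _ _ _) _ => //.
  - by move=> i i'; apply: pair_le.
  - move=> i; apply: le_trans (ler_sum _ (fun a _ => rowf_sqr_le1 i a w)) _.
    by rewrite sumr_const ler_nat card_div.
  rewrite ler_wpM2l ?sqr_ge0// lerD//.
    by rewrite ler_wpM2r// lerXn2r ?nnegrE// ler_nat.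
  by rewrite ler_wpM2r// ler_nat.
apply: le_trans (ler_sum _ (fun a _ => Yle a)) _.
have mulrN (x : R) : x *+ N = N%:R * x by rewrite mulr_natl.
rewrite big_split/= -mulr_sumr sumr_const card_ord mulrN.
have Ml : (n %/ l).+1%:R * l%:R <= 2 * N%:R :> R.
  rewrite -!natrM ler_nat mulSn mul2n -addnn leq_add// (leq_trans (leq_trunc_div _ _))//.
move: mainE Ml scale_large scale_small width_large.
rewrite exprMn sqr_sqrtr ?ler0n// /Vmart.
set M : R := (n %/ l).+1%:R; set L : R := l%:R; set S := Num.sqrt L.
set NN : R := N%:R; set B : R := b%:R; set A := \sum_a _.
have L0 : 0 < L by rewrite ltr0n.
have SL : S ^+ 2 = L by rewrite sqr_sqrtr// ltW.
have S0 : 0 < S by rewrite sqrtr_gt0.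
have N0 : 0 < NN by rewrite ltr0n.
have B0 : 0 < B by [].
have M0 : 0 <= M by [].
move=> hA hM hl hN hb.
have e1 : M * (dl ^+ 2 * NN * (B ^+ 2 * (dl * S) + B * L)) =
   (M * L) * (dl ^+ 2 * NN * (B ^+ 2 * dl / S + B)).
  rewrite -SL; field; exact: lt0r_neq0.
(* [scale_large] handles the correlations of distinct rows and [width_large] the diagonal; in [t3],
   [scale_small] handles the terms inside a block. With the factor 2 of [Yle] the shares of [Vmart]
   are 2/3 and 1/3. *)
have t1 : dl ^+ 2 * NN * (B ^+ 2 * dl / S + B) <= NN * B ^+ 2 / (6 * dl ^+ 2).
  have s1 : dl / S <= 1 / (12 * dl ^+ 4).
    rewrite ler_pdivrMr// mulrAC mul1r ler_pdivlMr ?mulr_gt0 ?exprn_gt0//.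
    apply: le_trans hl; rewrite le_eqVlt; apply/orP; left; apply/eqP; ring.
  have s2 : B <= B ^+ 2 / (12 * dl ^+ 4).
    rewrite ler_pdivlMr ?mulr_gt0 ?exprn_gt0// [B ^+ 2]expr2 ler_pM2l//.
  have -> : NN * B ^+ 2 / (6 * dl ^+ 2) =
     dl ^+ 2 * NN * (B ^+ 2 * (1 / (12 * dl ^+ 4)) + B ^+ 2 / (12 * dl ^+ 4)).
    field; exact: lt0r_neq0.
  have nn : 0 <= dl ^+ 2 * NN by rewrite mulr_ge0 ?sqr_ge0// ltW.
  by rewrite ler_wpM2l// lerD// -mulrA ler_wpM2l// sqr_ge0.
have t2 : A <= NN ^+ 2 * B ^+ 2 / (3 * dl ^+ 2).
  apply: le_trans hA _; rewrite e1.
  have -> : NN ^+ 2 * B ^+ 2 / (3 * dl ^+ 2) = (2 * NN) * (NN * B ^+ 2 / (6 * dl ^+ 2)).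
    field; exact: lt0r_neq0.
  apply: ler_pM => //; first by rewrite mulr_ge0 ?ltW.
  by rewrite !(mulr_ge0, addr_ge0, invr_ge0, sqr_ge0)// ltW.
have t3 : NN * (2 * (B * L) ^+ 2) <= NN ^+ 2 * B ^+ 2 / (3 * dl ^+ 2).
  have -> : NN * (2 * (B * L) ^+ 2) = NN * B ^+ 2 / (3 * dl ^+ 2) * (6 * L ^+ 2 * dl ^+ 2).
    field; exact: lt0r_neq0.
  have -> : NN ^+ 2 * B ^+ 2 / (3 * dl ^+ 2) = NN * B ^+ 2 / (3 * dl ^+ 2) * NN.
    field; exact: lt0r_neq0.
  by rewrite ler_wpM2l// divr_ge0 ?mulr_ge0 ?sqr_ge0// ltW.
have -> : (NN * B / dl) ^+ 2 = 2 * (NN ^+ 2 * B ^+ 2 / (3 * dl ^+ 2)) + NN ^+ 2 * B ^+ 2 / (3 * dl ^+ 2).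
  field; exact: lt0r_neq0.
by rewrite lerD// ler_wpM2l.
Qed.

(** The diagonal gives at most [N * b], twice the sum of the [Y a] another [2 * N * b]. What is
    bounded is the quadratic variation of the sum over a block as a martingale in the first
    coordinate; [mean_Weight_succ] deduces the size of that sum. *)
Lemma block_second_moment :
  prob (fun w => 3 * N%:R * b%:R < \sum_(i | I i) (\sum_j rowf i j w) ^+ 2)
  <= (N%:R ^+ 2 + N%:R ^+ 3 + 1) * (2 * expR (- (dl ^+ 2 / 8))).
Proof.
apply: (@le_trans _ _ (prob (fun w => (head_bad w || pair_bad w) || mart_bad w))).
  apply: prob_sub => w; apply: contraTT; rewrite !negb_or => /andP[/andP[hh hp] hm].
  have hY := quad_bound hh hp; move: hm; rewrite /mart_bad hY andbT -!leNgt => hm.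
  have -> : \sum_(i | I i) (\sum_j rowf i j w) ^+ 2 =
      \sum_(i | I i) \sum_j rowf i j w ^+ 2 + 2 * \sum_a Y a w.
    under eq_bigr do rewrite sqr_sum_lt.
    rewrite big_split/= -mulr_sumr; congr (_ + 2 * _).
    by rewrite exchange_big.
  have h1 : \sum_(i | I i) \sum_j rowf i j w ^+ 2 <= N%:R * b%:R.
    apply: (@le_trans _ _ (\sum_(i | I i) N%:R)).
      apply: ler_sum => i _; apply: le_trans (ler_sum _ (fun a _ => rowf_sqr_le1 i a w)) _.
      by rewrite sumr_const card_ord.
    by rewrite sumr_const -[leLHS]mulr_natr ler_wpM2l// ler_nat.
  have := ler_norm (\sum_a Y a w); lra.
apply: le_trans (prob_or _ _) _; rewrite mulrDl mul1r lerD//.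
by apply: le_trans (prob_or _ _) _; rewrite mulrDl lerD.
Qed.

End BlockSecondMoment.

(** * The test function *)

Section StronglyDistinct.
Variables (R : realType) (n : nat).
Local Notation N := n.+1.
Variable f : 'I_N -> 'I_N -> 'I_N -> cube N -> R.
Hypothesis hf : haar_family f.
Variables (rho : R) (bw : nat).
Hypotheses (rho_ge0 : 0 <= rho) (bw_gt0 : (0 < bw)%N).

(* Levels of the second ([inl]) and of the third ([inr]) coordinate. *)
Definition node := ('I_N + 'I_N)%type.
Definition edge (j k : 'I_N) : {set node} := [set inl j; inr k].
Implicit Types X Z : {set node}.

Lemma in_edge j k y : (y \in edge j k) = (y == inl j) || (y == inr k).
Proof. by rewrite !inE. Qed.

Definition avoids X (j k : 'I_N) := (inl j \notin X) && (inr k \notin X).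

(* The sum of the products [\prod rho * f i j k] with factors from distinct
   blocks among the first [t], no two of them sharing a level, that use no
   level of [X] and use every level of [Z]. *)
Fixpoint Psi (t : nat) X Z w : R :=
  if t is t'.+1 then
    Psi t' X Z w + rho * \sum_(i < N | (i %/ bw == t')%N) \sum_j \sum_k
      f i j k w * ((avoids X j k)%:R * Psi t' (X :|: edge j k) (Z :\: edge j k) w)
  else (Z == finset.set0)%:R.

(** A product either avoids the level [y] or uses it. In the recursion a factor through [y]
    contributes to the second term alone, and there [y] drops out of the levels still required. *)
Lemma Psi_split t X Z y w : y \notin X -> y \notin Z ->
  Psi t X Z w = Psi t (y |: X) Z w + Psi t X (y |: Z) w.
Proof.
elim: t X Z => [|t IH] X Z yX yZ.
  rewrite /= [X in _ + X](_ : _ = 0) ?addr0//.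
  by rewrite [in LHS](_ : _ == _ = false)//; apply/negbTE/set0Pn; exists y; rewrite !inE eqxx.
rewrite /= (IH X Z)// addrACA -mulrDr; congr (_ + rho * _).
rewrite -big_split; apply: eq_bigr => i _ /=; rewrite -big_split; apply: eq_bigr => j _ /=.
rewrite -big_split; apply: eq_bigr => k _ /=; rewrite -mulrDr; congr (_ * _).
have [ye|ye] := boolP (y \in edge j k).
  have -> : avoids (y |: X) j k = false.
    apply/negbTE; rewrite negb_and !negbK !inE.
    by move: ye; rewrite in_edge => /orP[]/eqP->; rewrite eqxx ?orbT.
  have -> : (y |: Z) :\: edge j k = Z :\: edge j k.
    by apply/finset.setP => x; rewrite finset.in_setD finset.in_setU1 finset.in_setD; have [->|//] := eqVneq x y; rewrite ye.
  by rewrite mul0r add0r.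
have -> : avoids (y |: X) j k = avoids X j k.
  move: ye; rewrite in_edge negb_or => /andP[yj yk].
  by rewrite /avoids !inE ![inl j == _]eq_sym ![inr k == _]eq_sym (negbTE yj) (negbTE yk).
have -> : (y |: Z) :\: edge j k = y |: (Z :\: edge j k).
  apply/finset.setP => x; rewrite finset.in_setU1 finset.in_setD finset.in_setU1 finset.in_setD.
  by have [->|//] := eqVneq x y; rewrite ye.
have -> : (y |: X) :|: edge j k = y |: (X :|: edge j k) by rewrite finset.setUA.
rewrite -mulrDr (IH (X :|: edge j k))//.
  by rewrite finset.in_setU negb_or yX.
by rewrite finset.in_setD (negbTE yZ) andbF.
Qed.

Lemma Psi_inv t X Z : inv c0 (t * bw) (Psi t X Z).
Proof.
elim: t X Z => [//|t IH] X Z.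
apply: (inv2 +%R).
  by apply: inv_le (IH X Z); rewrite leq_mul2r leqnSn orbT.
apply: (inv1 (fun x => rho * x)).
apply: inv_sum => i /eqP it; apply: inv_sum => j _; apply: inv_sum => k _.
apply: (inv2 *%R).
  apply: inv_le (fresh_inv (fam_fresh0 hf i j k)).
  by rewrite -it ltn_ceil.
apply: (inv1 (fun x => _ * x)); apply: inv_le (IH _ _).
by rewrite leq_mul2r leqnSn orbT.
Qed.

Lemma sum_f_le (P : pred 'I_N) (g : 'I_N -> 'I_N -> 'I_N -> R) (b : R) w :
  0 <= b -> (forall i j k, `|g i j k| <= b) ->
  `|\sum_(i | P i) \sum_j \sum_k f i j k w * g i j k| <= N%:R ^+ 2 * b.
Proof.
move=> b0 gb; apply: le_trans (ler_norm_sum _ _ _) _.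
apply: (@le_trans _ _ (\sum_(i : 'I_N) N%:R * b)); last first.
  by rewrite sumr_const card_ord -[leLHS]mulr_natl mulrA expr2.
apply: (@le_trans _ _ (\sum_i `|\sum_j \sum_k f i j k w * g i j k|)).
  rewrite [leRHS](bigID P)/= lerDl; exact: sumr_ge0.
apply: ler_sum => i _; apply: le_trans (ler_norm_sum _ _ _) _.
apply: (@le_trans _ _ (\sum_(j : 'I_N) b)); last by rewrite sumr_const card_ord mulr_natl.
apply: ler_sum => j _; apply: (@sum_unique _ _ (i + j)) => // k.
  by rewrite mulf_eq0 negb_or => /andP[/(fam_supp hf) + _]; rewrite addnC.
by rewrite normrM -[leRHS]mul1r ler_pM// (fam_le1 hf).
Qed.

(** The trivial bound, as a block has at most [N ^+ 2] nonzero summands. It is what remains on the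
    exceptional event and for bounded [n]. *)
Lemma Psi_sup t X Z w : `|Psi t X Z w| <= (1 + rho * N%:R ^+ 2) ^+ t.
Proof.
elim: t X Z => [|t IH] X Z /=; first by rewrite expr0 normr_nat lern1 leq_b1.
apply: le_trans (ler_normD _ _) _.
rewrite exprS mulrDl mul1r lerD// normrM ger0_norm// -mulrA ler_wpM2l//.
apply: sum_f_le; first by rewrite exprn_ge0// addr_ge0// mulr_ge0// sqr_ge0.
move=> i j k; rewrite normrM -[leRHS]mul1r ler_pM//.
by rewrite normr_nat lern1 leq_b1.
Qed.

Definition blockF t w : R := \sum_(i < N | (i %/ bw == t)%N) \sum_j \sum_k f i j k w.

(* Given the digits of the other coordinates and of the previous blocks, these
   are martingale differences in the first coordinate. *)
Definition remainder t X Z i w : R := rho * \sum_j \sum_k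
  f i j k w * ((avoids X j k)%:R * Psi t (X :|: edge j k) (Z :\: edge j k) w
               - Psi t X Z w).

Lemma Psi_succ t X Z w : Psi t.+1 X Z w = (1 + rho * blockF t w) * Psi t X Z w +
  \sum_(i < N | (i %/ bw == t)%N) remainder t X Z i w.
Proof.
rewrite /= mulrDl mul1r -addrA; congr (_ + _).
rewrite /remainder -mulr_sumr -mulrA -mulrDr; congr (_ * _).
rewrite /blockF mulr_suml -big_split; apply: eq_bigr => i _ /=.
rewrite mulr_suml -big_split; apply: eq_bigr => j _ /=.
rewrite mulr_suml -big_split; apply: eq_bigr => k _ /=.
by rewrite mulrBr addrC subrK.
Qed.

Lemma level_fresh (i : 'I_N) : fresh c0 i (fun w => \sum_j \sum_k f i j k w).
Proof. by do 2 apply: fresh_sum => ? _; apply: fam_fresh0. Qed.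

Lemma remainder_fresh t X Z (i : 'I_N) : (i %/ bw == t)%N -> fresh c0 i (remainder t X Z i).
Proof.
move=> /eqP it; rewrite /remainder.
have ti : (t * bw <= i)%N by rewrite -it leq_trunc_div.
apply: (@eq_fresh _ _ _ _ (fun w => (\sum_j \sum_k
  f i j k w * ((avoids X j k)%:R * Psi t (X :|: edge j k) (Z :\: edge j k) w
               - Psi t X Z w)) * rho)).
  by move=> w; rewrite mulrC.
apply: fresh_mul; last exact: inv_cst.
do 2 apply: fresh_sum => ? _; apply: fresh_mul; first exact: fam_fresh0.
apply: (inv2 (fun x y => x - y)); last exact: (inv_le ti (@Psi_inv t _ _)).
apply: (inv1 (fun x => _ * x)); exact: (inv_le ti (@Psi_inv t _ _)).
Qed.

Definition colf i k w : R := \sum_j f i j k w.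

Lemma colf_le1 i k w : `|colf i k w| <= 1.
Proof.
apply: (@sum_unique _ _ (i + k)) => // j; last exact: fam_le1.
by move/(fam_supp hf); lia.
Qed.

Lemma colf_sqr_le1 i k w : colf i k w ^+ 2 <= 1.
Proof. by rewrite -real_normK ?num_real// expr_le1// colf_le1. Qed.

(* Away from [X] and [Z], [Psi_split] turns the increment [cc] into terms [v]
   depending on one level only, summed by almost orthogonality, and [D], of
   order [lam ^+ 2]. The other pairs [touch] are few. *)
Section Step.
Variables (t : nat) (w : cube N) (X Z : {set node}) (M : nat) (lam p B : R).
Hypotheses (cardXZ : (#|X| + #|Z| <= M)%N) (lam_gt0 : 0 < lam) (lam_le1 : lam <= 1)
  (p_ge0 : 0 <= p) (B_ge0 : 0 <= B)
  (row_pairs : forall j j', j != j' ->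
     `|\sum_(i < N | (i %/ bw == t)%N) rowf f i j w * rowf f i j' w| <= p)
  (col_pairs : forall k k', k != k' ->
     `|\sum_(i < N | (i %/ bw == t)%N) colf i k w * colf i k' w| <= p)
  (Psi_le : forall X' Z', (#|X'| + #|Z'| <= #|X| + #|Z| + 2)%N ->
     `|Psi t X' Z' w| <= lam ^+ #|Z'| * B).

Let U := X :|: Z.
Let L := lam ^+ #|Z| * B.
Let both j k : bool := (inl j \in Z) && (inr k \in Z).
Let touch j k : bool := (inl j \in U) || (inr k \in U).
Let cc j k := (avoids X j k)%:R * Psi t (X :|: edge j k) (Z :\: edge j k) w
               - Psi t X Z w.
Let v (y : node) := (y \notin U)%:R * Psi t X (y |: Z) w.
Let D j k := Psi t X (inr k |: (inl j |: Z)) w.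

Let L_ge0 : 0 <= L. Proof. by rewrite mulr_ge0// exprn_ge0// ltW. Qed.

Let v_le y : `|v y| <= lam * L.
Proof.
rewrite /v; case: (boolP (y \in U)) => [_|yU]/=.
  by rewrite mul0r normr0 mulr_ge0// ltW.
rewrite mul1r; apply: le_trans (Psi_le _) _; rewrite cardsU1.
  by case: (_ \notin _); clear; lia.
have yZ : y \notin Z by move: yU; rewrite finset.in_setU negb_or => /andP[].
by rewrite yZ add1n exprS -mulrA.
Qed.

Let D_le j k : ~~ touch j k -> `|D j k| <= lam ^+ 2 * L.
Proof.
rewrite negb_or => /andP[jU kU].
have jZ : inl j \notin Z by move: jU; rewrite finset.in_setU negb_or => /andP[].
have kZ : inr k \notin inl j |: Z.
  by rewrite finset.in_setU1; move: kU; rewrite finset.in_setU negb_or => /andP[].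
have cE : #|inr k |: (inl j |: Z)| = #|Z|.+2 by rewrite !cardsU1 jZ kZ !add1n.
apply: le_trans (Psi_le _) _; rewrite cE; first by clear; lia.
by rewrite -addn2 exprD -mulrA mulrCA.
Qed.

(** Inclusion and exclusion over the two levels: avoiding both is everything, minus using [j], minus
    using [k], plus using both. *)
Let cc_split j k : ~~ touch j k -> cc j k = - v (inl j) - v (inr k) + D j k.
Proof.
rewrite negb_or /v => /andP[jU kU]; rewrite jU kU !mul1r.
move: jU kU; rewrite !finset.in_setU !negb_or => /andP[jX jZ] /andP[kX kZ].
rewrite /cc /avoids jX kX mul1r.
have -> : Z :\: edge j k = Z.
  apply/finset.setP => x; rewrite finset.in_setD in_edge negb_or.
  have [->|_] := eqVneq x (inl j); first by rewrite (negbTE jZ).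
  by have [->|_] := eqVneq x (inr k); first by rewrite (negbTE kZ).
have -> : X :|: edge j k = inr k |: (inl j |: X).
  apply/finset.setP => x; rewrite finset.in_setU in_edge !finset.in_setU1.
  by case: (x \in X); case: (x == inl j); case: (x == inr k).
have e1 := Psi_split t w jX jZ.
have e2 := @Psi_split t (inl j |: X) Z (inr k) w.
have e3 := @Psi_split t X (inl j |: Z) (inr k) w.
have e4 := Psi_split t w kX kZ.
have e5 := @Psi_split t (inr k |: X) Z (inl j) w.
rewrite /D.
have h2 : inr k \notin inl j |: X by rewrite finset.in_setU1.
have h3 : inr k \notin inl j |: Z by rewrite finset.in_setU1.
have := e2 h2 kZ; have := e3 kX h3.
have e6 := @Psi_split t X (inr k |: Z) (inl j) w jX.
have h6 : inl j \notin inr k |: Z by rewrite finset.in_setU1.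
have := e6 h6; rewrite (finset.setUCA [set inl j]).
rewrite e1; lra.
Qed.

(** Removing [edge j k] from [Z] loses at most one power of [lam], or two if both levels lie in [Z].
    The terms [v] are added back so that [a1] and [a2] below can run over all pairs. *)
Let touch_le j k : touch j k ->
  `|cc j k + v (inl j) + v (inr k)| <= L * (4 / lam + (both j k)%:R / lam ^+ 2).
Proof.
move=> _.
have il : 1 <= 1 / lam by rewrite ler_pdivlMr// mul1r.
have b1 : `|Psi t X Z w| <= L * (1 / lam).
  by apply: le_trans (Psi_le (leq_addr 2 _)) _; rewrite ler_peMr.
have b2 y : `|v y| <= L * (1 / lam).
  apply: le_trans (v_le y) _; rewrite mulrC ler_wpM2l//.
  exact: le_trans il.
have b3 : `|(avoids X j k)%:R * Psi t (X :|: edge j k) (Z :\: edge j k) w| <=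
    L * (1 / lam + (both j k)%:R / lam ^+ 2).
  have ce : (#|edge j k| <= 2)%N by rewrite cards2; case: (_ != _).
  apply: (@le_trans _ _ (lam ^+ #|Z :\: edge j k| * B)).
    rewrite normrM -[leRHS]mul1r ler_pM//; first by rewrite normr_nat lern1 leq_b1.
    apply: Psi_le; have := cardsU X (edge j k); have := cardsD Z (edge j k).
    by move: ce; clear; lia.
  rewrite /L mulrAC ler_wpM2r//.
  have lp m : 0 <= lam ^+ m by rewrite exprn_ge0// ltW.
  have card_int : (#|Z :&: edge j k| <= 1 + both j k)%N.
    have : (#|Z :&: edge j k| <= (inl j \in Z) + (inr k \in Z))%N.
      have -> : Z :&: edge j k = (Z :&: [set inl j]) :|: (Z :&: [set inr k]) by rewrite finset.setIUr.
      rewrite cardsU; apply: leq_trans (leq_subr _ _) _.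
      apply: leq_add.
        case: (boolP (inl j \in Z)) => h; first by rewrite (leq_trans (subset_leq_card (finset.subsetIr _ _)))// cards1.
        rewrite leqn0 cards_eq0; apply/eqP/finset.setP => x; rewrite !inE.
        by case: eqP => [->|]; rewrite ?andbF ?(negbTE h).
      case: (boolP (inr k \in Z)) => h; first by rewrite (leq_trans (subset_leq_card (finset.subsetIr _ _)))// cards1.
      rewrite leqn0 cards_eq0; apply/eqP/finset.setP => x; rewrite !inE.
      by case: eqP => [->|]; rewrite ?andbF ?(negbTE h).
    by rewrite /both; case: (inl j \in Z); case: (inr k \in Z); clear; lia.
  have cz : (#|Z| <= #|Z :\: edge j k| + (1 + both j k))%N.
    by have := cardsD Z (edge j k); have := subset_leq_card (finset.subsetIl Z (edge j k));
      move: card_int; clear; lia.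
  apply: (@le_trans _ _ (lam ^+ #|Z| / lam ^+ (1 + both j k))).
    rewrite ler_pdivlMr ?exprn_gt0// -exprD; apply: ler_wiXn2l => //; exact: ltW.
  rewrite ler_wpM2l//; case: (both j k); rewrite /= ?mul0r ?addr0 ?div1r ?addn0 ?expr1//.
  by rewrite lerDr invr_ge0 ltW.
rewrite /cc; apply: le_trans (ler_normD _ _) _.
apply: le_trans (lerD (ler_normD _ _) (b2 _)) _.
apply: le_trans (lerD (lerD (ler_normB _ _) (b2 _)) (lexx _)) _.
have -> : 4 / lam = 1 / lam + 1 / lam + 1 / lam + 1 / lam by field; rewrite gt_eqF.
move: b1 b3; lra.
Qed.

Let fabs i : \sum_j \sum_k `|f i j k w| <= N%:R.
Proof.
apply: (@le_trans _ _ (\sum_(j : 'I_N) 1)); last by rewrite sumr_const card_ord.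
apply: ler_sum => j _; apply: (@sum_norm_unique _ _ (i + j)) => // k; last exact: fam_le1.
by move/(fam_supp hf); rewrite addnC.
Qed.

Let nb i := \sum_j \sum_k `|f i j k w| * (both j k)%:R.

Let card_inl (S : {set node}) : (#|[pred j | inl j \in S]| <= #|S|)%N.
Proof.
have injK : injective (@inl 'I_N 'I_N) by move=> x y [].
rewrite -(fintype.card_image injK).
apply/subset_leq_card/fintype.subsetP => x /fintype.imageP[j jS ->]; exact: jS.
Qed.

Let card_inr (S : {set node}) : (#|[pred j | inr j \in S]| <= #|S|)%N.
Proof.
have injK : injective (@inr 'I_N 'I_N) by move=> x y [].
rewrite -(fintype.card_image injK).
apply/subset_leq_card/fintype.subsetP => x /fintype.imageP[j jS ->]; exact: jS.
Qed.

Let sum_inl i (S : {set node}) : \sum_j \sum_k `|f i j k w| * (inl j \in S)%:R <= #|S|%:R.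
Proof.
apply: (@le_trans _ _ #|[pred j | inl j \in S]|%:R); last by rewrite ler_nat card_inl.
rewrite -sumr_const [leRHS]big_mkcond/=; apply: ler_sum => j _; rewrite inE.
rewrite -mulr_suml; case: (_ \in S); rewrite ?mulr0// mulr1.
apply: (@sum_norm_unique _ _ (i + j)) => // k; last exact: fam_le1.
by move/(fam_supp hf); rewrite addnC.
Qed.

Let sum_inr i (S : {set node}) : \sum_j \sum_k `|f i j k w| * (inr k \in S)%:R <= #|S|%:R.
Proof.
apply: (@le_trans _ _ #|[pred j | inr j \in S]|%:R); last by rewrite ler_nat card_inr.
rewrite exchange_big/=.
rewrite -sumr_const [leRHS]big_mkcond/=; apply: ler_sum => k _; rewrite inE.
rewrite -mulr_suml; case: (_ \in S); rewrite ?mulr0// mulr1.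
apply: (@sum_norm_unique _ _ (i + k)) => // j; last exact: fam_le1.
by move/(fam_supp hf); lia.
Qed.

Let nb_ge0 i : 0 <= nb i.
Proof. by do 2 apply: sumr_ge0 => ? _; rewrite mulr_ge0. Qed.

Let nb_le i : nb i <= M%:R.
Proof.
apply: le_trans (_ : #|Z|%:R <= _); last by rewrite ler_nat (leq_trans (leq_addl _ _) cardXZ).
apply: le_trans (sum_inl i Z); do 2 apply: ler_sum => ? _.
by rewrite ler_wpM2l// ler_nat /both; case: (inl _ \in Z); rewrite /= ?leq_b1.
Qed.

(** A pair [(j, k)] determines [i], so the whole block sees each pair inside [Z] at most once.
    Together with [nb_le], the squares of [nb] sum to at most [M ^+ 3] instead of [N * M ^+ 2]. *)
Let sum_nb : \sum_(i < N | (i %/ bw == t)%N) nb i <= M%:R ^+ 2.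
Proof.
apply: (@le_trans _ _ (\sum_j \sum_k (both j k)%:R)).
  rewrite /nb exchange_big; apply: ler_sum => j _ /=.
  rewrite exchange_big; apply: ler_sum => k _ /=.
  rewrite -mulr_suml ler_piMl//.
  apply: (@sum_norm_unique _ _ (j + k)) => // i; last exact: fam_le1.
  by move/(fam_supp hf); rewrite addnA.
have -> : \sum_j \sum_k (both j k)%:R =
    (\sum_j (inl j \in Z)%:R) * (\sum_k (inr k \in Z)%:R) :> R.
  by rewrite big_distrlr; do 2 apply: eq_bigr => ? _ /=; rewrite -natrM mulnb.
have s1 : \sum_j (inl j \in Z)%:R <= M%:R :> R.
  rewrite -natr_sum ler_nat; apply: leq_trans (_ : #|Z| <= _)%N;
    last exact: leq_trans (leq_addl _ _) cardXZ.
  by apply: leq_trans (card_inl Z); rewrite -sum1_card [leqRHS]big_mkcond.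
have s2 : \sum_k (inr k \in Z)%:R <= M%:R :> R.
  rewrite -natr_sum ler_nat; apply: leq_trans (_ : #|Z| <= _)%N;
    last exact: leq_trans (leq_addl _ _) cardXZ.
  by apply: leq_trans (card_inr Z); rewrite -sum1_card [leqRHS]big_mkcond.
by rewrite expr2 ler_pM// sumr_ge0.
Qed.

Let a1 i := \sum_j v (inl j) * rowf f i j w.
Let a2 i := \sum_k v (inr k) * colf i k w.
Let a3 i := \sum_j \sum_k f i j k w * ((~~ touch j k)%:R * D j k).
Let a4 i := \sum_j \sum_k f i j k w *
  ((touch j k)%:R * (cc j k + v (inl j) + v (inr k))).

Let remainderE i : remainder t X Z i w = rho * (- a1 i - a2 i + a3 i + a4 i).
Proof.
rewrite /remainder; congr (_ * _).
have -> : a1 i = \sum_j \sum_k f i j k w * v (inl j).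
  by apply: eq_bigr => j _; rewrite /rowf mulr_sumr; apply: eq_bigr => k _; rewrite mulrC.
have -> : a2 i = \sum_j \sum_k f i j k w * v (inr k).
  rewrite exchange_big; apply: eq_bigr => j _.
  by rewrite /colf mulr_sumr; apply: eq_bigr => k _; rewrite mulrC.
rewrite -!sumrN -!big_split; apply: eq_bigr => j _ /=.
rewrite -!sumrN -!big_split; apply: eq_bigr => k _ /=.
rewrite -/(cc j k); case: (boolP (touch j k)) => [_|/cc_split->] /=; ring.
Qed.

Let a12_le (h : 'I_N -> 'I_N -> R) (y : 'I_N -> node) :
  (forall i j, h i j ^+ 2 <= 1) ->
  (forall j j', j != j' ->
     `|\sum_(i < N | (i %/ bw == t)%N) h i j * h i j'| <= p) ->
  \sum_(i < N | (i %/ bw == t)%N) (\sum_j v (y j) * h i j) ^+ 2 <=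
  L ^+ 2 * (lam ^+ 2 * (N%:R ^+ 2 * (p + 1))).
Proof.
move=> h1 hp.
apply: le_trans (@quad_le R _ _ xpredT (fun i : 'I_N => i %/ bw == t)%N
   (fun j => v (y j)) (fun j i => h i j) (lam * L) p N%:R p_ge0 _ _ _ _) _ => //.
- move=> j; apply: le_trans (ler_sum _ (fun i _ => h1 i j)) _.
  by rewrite sumr_const ler_nat -[leqRHS]card_ord max_card.
- rewrite cardT size_enum_ord; lra.
Qed.

Let a3_le i : `|a3 i| <= L * (N%:R * lam ^+ 2).
Proof.
rewrite mulrCA [L * _]mulrC.
apply: (@le_trans _ _ (\sum_j \sum_k `|f i j k w| * (lam ^+ 2 * L))).
  apply: le_trans (ler_norm_sum _ _ _) _; apply: ler_sum => j _.
  apply: le_trans (ler_norm_sum _ _ _) _; apply: ler_sum => k _.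
  rewrite normrM ler_wpM2l//; case: (boolP (touch j k)) => h.
    by rewrite mul0r normr0 mulr_ge0// sqr_ge0.
  by rewrite mul1r D_le.
under eq_bigr do rewrite -mulr_suml.
by rewrite -mulr_suml ler_wpM2r// mulr_ge0// sqr_ge0.
Qed.

Let a4_le i : `|a4 i| <= L * (8 * M%:R / lam + nb i / lam ^+ 2).
Proof.
apply: (@le_trans _ _ (\sum_j \sum_k `|f i j k w| * (((inl j \in U)%:R + (inr k \in U)%:R) *
    (L * (4 / lam)) + (both j k)%:R * (L / lam ^+ 2)))).
  apply: le_trans (ler_norm_sum _ _ _) _; apply: ler_sum => j _.
  apply: le_trans (ler_norm_sum _ _ _) _; apply: ler_sum => k _.
  rewrite normrM ler_wpM2l//.
  have pos1 : 0 <= L * (4 / lam) by rewrite mulr_ge0// divr_ge0// ltW.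
  have pos2 : 0 <= L / lam ^+ 2 by rewrite divr_ge0// sqr_ge0.
  case: (boolP (touch j k)) => h.
    rewrite mul1r; apply: le_trans (touch_le h) _.
    rewrite mulrDr lerD//; last by rewrite mulrCA.
    rewrite ler_peMl//; move: h; rewrite /touch.
    by case: (_ \in U); case: (_ \in U); rewrite //= ?addr0 ?add0r// lerDl.
  by rewrite mul0r normr0 addr_ge0// mulr_ge0// addr_ge0.
have -> : \sum_j \sum_k `|f i j k w| * (((inl j \in U)%:R + (inr k \in U)%:R) *
    (L * (4 / lam)) + (both j k)%:R * (L / lam ^+ 2)) =
  (\sum_j \sum_k `|f i j k w| * (inl j \in U)%:R) * (L * (4 / lam)) +
  (\sum_j \sum_k `|f i j k w| * (inr k \in U)%:R) * (L * (4 / lam)) +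
  nb i * (L / lam ^+ 2).
  rewrite /nb !mulr_suml -!big_split; apply: eq_bigr => j _ /=.
  rewrite !mulr_suml -!big_split; apply: eq_bigr => k _ /=; ring.
have UM : #|U|%:R <= M%:R :> R.
  by rewrite ler_nat; have := cardsU X Z; rewrite -/U; move: cardXZ; clear; lia.
have pos1 : 0 <= L * (4 / lam) by rewrite mulr_ge0// divr_ge0// ltW.
have u1 := ler_wpM2r pos1 (le_trans (sum_inl i U) UM).
have u2 := ler_wpM2r pos1 (le_trans (sum_inr i U) UM).
apply: le_trans (lerD (lerD u1 u2) (lexx _)) _.
rewrite le_eqVlt; apply/orP; left; apply/eqP; field; exact: lt0r_neq0.
Qed.

(** The four terms come from one further level, from two, from pairs meeting [X] or [Z], and from
    pairs inside [Z]. *)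
Lemma remainder_sqr_le : \sum_(i < N | (i %/ bw == t)%N) remainder t X Z i w ^+ 2 <=
  5 * rho ^+ 2 * (lam ^+ #|Z| * B) ^+ 2 *
  (2 * (lam ^+ 2 * (N%:R ^+ 2 * (p + 1))) + N%:R ^+ 3 * lam ^+ 4 +
   64 * M%:R ^+ 2 * N%:R / lam ^+ 2 + M%:R ^+ 3 / lam ^+ 4).
Proof.
have key i : remainder t X Z i w ^+ 2 <= 5 * rho ^+ 2 * (a1 i ^+ 2 + a2 i ^+ 2 +
   (L * (N%:R * lam ^+ 2)) ^+ 2 + (L * (8 * M%:R / lam)) ^+ 2 +
   L ^+ 2 * (M%:R / lam ^+ 4) * nb i).
  rewrite remainderE exprMn -[leRHS]mulrA [leRHS]mulrCA ler_wpM2l ?sqr_ge0//.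
  have h3 : a3 i ^+ 2 <= (L * (N%:R * lam ^+ 2)) ^+ 2.
    rewrite -(@real_normK _ (a3 i)) ?num_real// lerXn2r ?nnegrE//.
    by rewrite mulr_ge0// mulr_ge0// sqr_ge0.
  pose x4 := L * (8 * M%:R / lam); pose y4 := L * (nb i / lam ^+ 2).
  have x40 : 0 <= x4 by rewrite mulr_ge0// divr_ge0 ?mulr_ge0// ltW.
  have y40 : 0 <= y4 by rewrite mulr_ge0// divr_ge0 ?sqr_ge0.
  have h4 : a4 i ^+ 2 <= (x4 + y4) ^+ 2.
    rewrite -(@real_normK _ (a4 i)) ?num_real// lerXn2r ?nnegrE// ?addr_ge0//.
    by rewrite /x4 /y4 -mulrDr a4_le.
  have h5 : y4 ^+ 2 <= L ^+ 2 * (M%:R / lam ^+ 4) * nb i.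
    have -> : y4 ^+ 2 = L ^+ 2 / lam ^+ 4 * (nb i * nb i).
      rewrite /y4; field; exact: lt0r_neq0.
    have -> : L ^+ 2 * (M%:R / lam ^+ 4) * nb i = L ^+ 2 / lam ^+ 4 * (M%:R * nb i) by ring.
    by rewrite ler_wpM2l ?divr_ge0 ?sqr_ge0 ?exprn_ge0 ?(ltW lam_gt0)// ler_wpM2r.
  have cs (x y z u s r : R) : r ^+ 2 <= (u + s) ^+ 2 -> 0 <= u -> 0 <= s ->
     (- x - y + z + r) ^+ 2 <= 5 * (x ^+ 2 + y ^+ 2 + z ^+ 2 + u ^+ 2 + s ^+ 2).
    move=> hr u0 s0.
    have us : (u + s) ^+ 2 <= 2 * u ^+ 2 + 2 * s ^+ 2 by have := sqr_ge0 (u - s); nra.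
    have : (- x - y + z + r) ^+ 2 <= 5 * (x ^+ 2 + y ^+ 2 + z ^+ 2) + 5 / 2 * r ^+ 2.
      have := sqr_ge0 (2 * x + r); have := sqr_ge0 (2 * y + r); have := sqr_ge0 (2 * z - r).
      have := sqr_ge0 (x - y); have := sqr_ge0 (x + z); have := sqr_ge0 (y + z).
      by nra.
    by move=> /le_trans; apply; lra.
  apply: le_trans (cs _ _ _ _ _ _ h4 x40 y40) _.
  rewrite ler_pM2l// lerD// lerD// lerD//.
apply: le_trans (ler_sum _ (fun i _ => key i)) _.
rewrite -mulr_sumr -[leRHS]mulrA ler_wpM2l ?mulr_ge0 ?sqr_ge0//.
rewrite !big_split/= -/L.
have b1 := @a12_le (fun i j => rowf f i j w) (fun j => inl j)
  (fun i j => rowf_sqr_le1 hf i j w) row_pairs.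
have b2 := @a12_le (fun i k => colf i k w) (fun k => inr k)
  (fun i k => colf_sqr_le1 i k w) col_pairs.
have sc (x : R) : 0 <= x -> \sum_(i < N | (i %/ bw == t)%N) x <= N%:R * x.
  move=> x0; rewrite sumr_const -[leLHS]mulr_natl ler_wpM2r// ler_nat.
  by rewrite -[leqRHS]card_ord max_card.
have b3 := sc _ (sqr_ge0 (L * (N%:R * lam ^+ 2))).
have b4 := sc _ (sqr_ge0 (L * (8 * M%:R / lam))).
have b5 : \sum_(i < N | (i %/ bw == t)%N) L ^+ 2 * (M%:R / lam ^+ 4) * nb i <=
   L ^+ 2 * (M%:R / lam ^+ 4) * M%:R ^+ 2.
  rewrite -mulr_sumr ler_wpM2l// mulr_ge0 ?sqr_ge0// divr_ge0// exprn_ge0// ltW//.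
apply: le_trans (lerD (lerD (lerD (lerD b1 b2) b3) b4) b5) _.
rewrite le_eqVlt; apply/orP; left; apply/eqP; field; exact: lt0r_neq0.
Qed.

End Step.

End StronglyDistinct.

Lemma card_small_sets (T : finType) (m : nat) :
  (#|[pred X : {set T} | (#|X| <= m)%N]| <= #|T|.+1 ^ m)%N.
Proof.
pose g (h : {ffun 'I_m -> option T}) : {set T} := [set x | Some x \in codom h].
have -> : (#|T|.+1 ^ m)%N = #|{: {ffun 'I_m -> option T}}|.
  by rewrite card_ffun card_option card_ord.
apply: leq_trans (leq_image_card g _); apply/subset_leq_card/fintype.subsetP => X.
rewrite inE => Xm; apply/fintype.imageP.
exists [ffun i : 'I_m => nth None (map Some (enum X)) i] => //.
apply/finset.setP => x; rewrite inE; apply/idP/idP => [xX|/codomP[i]].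
  have xi : (index x (enum X) < #|X|)%N by rewrite cardE index_mem mem_enum.
  apply/codomP; exists (Ordinal (leq_trans xi Xm)); rewrite ffunE/=.
  by rewrite (nth_map x) -?cardE// nth_index// mem_enum.
rewrite ffunE; have [iX|iX] := ltnP i (size (enum X)).
  by rewrite (nth_map x)// => -[->]; rewrite -mem_enum mem_nth.
by rewrite nth_default// size_map.
Qed.

(** * The L^1 norm of the test function *)

Section L1Bound.
Variables (R : realType) (n : nat).
Local Notation N := n.+1.
Variable f : 'I_N -> 'I_N -> 'I_N -> cube N -> R.
Hypothesis hf : haar_family f.
Variables (rho : R) (bw q : nat) (lam dl : R) (l : nat).
Hypotheses (rho_gt0 : 0 < rho) (bw_gt0 : (0 < bw)%N) (q_gt0 : (0 < q)%N)
  (lam_gt0 : 0 < lam) (lam_le1 : lam <= 1) (dl_ge1 : 1 <= dl).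

Let dl_gt0 : 0 < dl. Proof. exact: lt_le_trans dl_ge1. Qed.
Let qR : 0 < q%:R :> R. Proof. by rewrite ltr0n. Qed.

Let one_plus_inv_exp : (1 + q%:R^-1) ^+ q <= expR 1 :> R.
Proof.
apply: (@le_trans _ _ (expR q%:R^-1 ^+ q)); last first.
  by rewrite -expRM_natl mulfV// gt_eqF.
by rewrite lerXn2r ?nnegrE ?expR_ge0 ?addr_ge0 ?invr_ge0 ?(ltW qR)// expR_ge1Dx.
Qed.

Local Notation Psi := (Psi f rho bw).
Local Notation blockF := (blockF f bw).
Local Notation blk t := (fun i : 'I_N => (i %/ bw == t)%N).
Local Notation pairb := (dl * Num.sqrt N%:R).
Local Notation eps := (2 * expR (- (dl ^+ 2 / 8)) : R).

(* The floor [1 / 2] lets [Psi_le_Bound] absorb additive errors into the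
   factor [1 + q^-1], and costs nothing unless [rho * blockF t] is large. *)
Definition weight t w : R := Num.max `|1 + rho * blockF t w| (1 / 2).
Definition Weight (t : nat) w : R := \prod_(s < t) weight s w.
Definition Bound (t : nat) w : R := (1 + q%:R^-1) ^+ t * Weight t w.

Lemma weight_ge t w : 1 / 2 <= weight t w.
Proof. by rewrite /weight le_max lexx orbT. Qed.

Lemma Weight_gt0 t w : 0 < Weight t w.
Proof. by apply: prodr_gt0 => s _; apply: lt_le_trans (weight_ge _ _). Qed.

Lemma Bound_gt0 t w : 0 < Bound t w.
Proof. by rewrite mulr_gt0 ?Weight_gt0// exprn_gt0// addr_gt0// invr_gt0. Qed.

Lemma blockF_inv (s t : nat) : (s < t)%N -> inv c0 (t * bw) (blockF s).
Proof.
move=> st; apply: inv_sum => i /eqP it.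
apply: (@inv_le _ _ _ i.+1); last exact: (fresh_inv (level_fresh hf i)).
by rewrite -it in st; rewrite (leq_trans (ltn_ceil _ bw_gt0))// leq_mul2r st orbT.
Qed.

Lemma Weight_inv t : inv c0 (t * bw) (Weight t).
Proof.
apply: inv_prod => s _; apply: (inv1 (fun x => Num.max `|1 + rho * x| (1 / 2))).
exact: blockF_inv.
Qed.

Definition row_bad w := [exists a : 'I_q * 'I_N * 'I_N, (a.1.2 < a.2)%N &&
  (pairb < `|\sum_(i | blk a.1.1 i) rowf f i a.1.2 w * rowf f i a.2 w|)].

Definition col_bad w := [exists a : 'I_q * 'I_N * 'I_N, (a.1.2 < a.2)%N &&
  (pairb < `|\sum_(i | blk a.1.1 i) colf f i a.1.2 w * colf f i a.2 w|)].

(** The normalization depends on earlier digits only, so the martingale property survives, and one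
    threshold serves all [X], [Z] and all values of [Bound]. *)
Definition nrem t (X Z : {set node n}) (i : 'I_N) w : R :=
  remainder f rho bw t X Z i w * (lam ^+ #|Z| * Bound t w)^-1.

Local Notation Vrem := (((2 * q%:R * dl)^-1) ^+ 2 : R).

(** The clause on the squares makes Azuma's inequality apply unconditionally; that it holds is
    proved afterwards, in [Psi_le_Bound]. Sizes up to [2 * q] suffice since each block adds one
    edge. *)
Definition rem_bad w :=
  [exists a : 'I_q * ({set node n} * {set node n}), (#|a.2.1| + #|a.2.2| <= 2 * q)%N &&
   (((2 * q%:R)^-1 < `|\sum_(i | blk a.1 i) nrem a.1 a.2.1 a.2.2 i w|) &&
    (\sum_(i | blk a.1 i) nrem a.1 a.2.1 a.2.2 i w ^+ 2 <= Vrem))].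

Let eps_ge0 : 0 <= eps. Proof. by rewrite mulr_ge0 ?expR_ge0. Qed.

Let card_blk t : #|blk t|%:R <= N%:R :> R.
Proof. by rewrite ler_nat -[leqRHS]card_ord max_card. Qed.

Let N_gt0 : 0 < N%:R :> R. Proof. by rewrite ltr0n. Qed.

Let card_triple (P : pred ('I_q * 'I_N * 'I_N)) : #|P|%:R <= q%:R * N%:R ^+ 2 :> R.
Proof.
by rewrite -natrX -natrM ler_nat (leq_trans (max_card _))// !card_prod !card_ord -mulnA.
Qed.

(** For [j < j'] the row of [j] has the finer third level, so the correlation is a martingale in the
    third coordinate. Columns are treated alike in the second. *)
Lemma prob_row_bad : prob row_bad <= q%:R * N%:R ^+ 2 * eps.
Proof.
apply: le_trans (prob_exists eps_ge0 _) _ => [[[t j] j'] /= jj'|]; last first.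
  by rewrite ler_wpM2r// card_triple.
apply: (@pair_tail R n c2 (blk t) (fun i k => f i j k) (fun i k => f i j' k) j j') => //.
- exact: ltW.
- by move=> x k; apply: fam_fresh2.
- by move=> x k; apply: fresh_inv; apply: fam_fresh2.
- by move=> x k w /(fam_supp hf).
- by move=> x k w /(fam_supp hf).
- by move=> x k w; apply: fam_le1.
- by move=> x k w; apply: fam_le1.
Qed.

Lemma prob_col_bad : prob col_bad <= q%:R * N%:R ^+ 2 * eps.
Proof.
apply: le_trans (prob_exists eps_ge0 _) _ => [[[t k] k'] /= kk'|]; last first.
  by rewrite ler_wpM2r// card_triple.
apply: (@pair_tail R n c1 (blk t) (fun i j => f i j k) (fun i j => f i j k') k k') => //.
- exact: ltW.
- by move=> x j; apply: fam_fresh1.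
- by move=> x j; apply: fresh_inv; apply: fam_fresh1.
- by move=> x j w /(fam_supp hf); rewrite addnAC.
- by move=> x j w /(fam_supp hf); rewrite addnAC.
- by move=> x j w; apply: fam_le1.
- by move=> x j w; apply: fam_le1.
Qed.

Lemma prob_rem_bad : prob rem_bad <= q%:R * (2 * N%:R + 1) ^+ (4 * q) * eps.
Proof.
apply: le_trans (prob_exists eps_ge0 _) _ => [[t [X Z]] /= XZ|]; last first.
  rewrite ler_wpM2r//; apply: (@le_trans _ _ (q * ((2 * N).+1 ^ (2 * q)) ^ 2)%:R).
    rewrite ler_nat.
    pose S := [pred X : {set node n} | (#|X| <= 2 * q)%N].
    have cS : (#|S| <= (2 * N).+1 ^ (2 * q))%N.
      apply: leq_trans (card_small_sets _ _) _.
      by rewrite /node card_sum !card_ord addnn -mul2n.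
    apply: (@leq_trans #|[predX 'I_q & [predX S & S]]|).
      apply/subset_leq_card/fintype.subsetP => -[t [X Z]] /=.
      rewrite !inE/= unfold_in/= => XZ.
      by apply/andP; split; apply: leq_trans XZ; rewrite ?leq_addr ?leq_addl.
    by rewrite !cardX card_ord leq_mul2l leq_mul// orbT.
  by rewrite natrM natrX natrX -exprM mulnAC -[X in _ <= q%:R * (X + _) ^+ _]natrM natr1 mulnC.
have h1 (i : 'I_N) : blk t i -> fresh c0 i (nrem t X Z i).
  move=> it; apply: fresh_mul; first exact: remainder_fresh.
  have ti : (t * bw <= i)%N by rewrite -(eqP it) leq_trunc_div.
  apply: (inv1 (fun x => (lam ^+ #|Z| * ((1 + q%:R^-1) ^+ t * x))^-1)).
  exact: (inv_le ti (@Weight_inv t)).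
have := @azuma_tail R N c0 (blk t) (nrem t X Z) Vrem dl _ (ltW dl_gt0) h1.
have -> : dl * Num.sqrt Vrem = (2 * q%:R)^-1.
  rewrite sqrtr_sqr ger0_norm ?invr_ge0 ?mulr_ge0 ?ler0n ?ltW//.
  by field; rewrite !lt0r_neq0.
by apply; rewrite exprn_gt0// invr_gt0 !mulr_gt0.
Qed.

Hypothesis remainder_small : 5 * rho ^+ 2 *
  (2 * (lam ^+ 2 * (N%:R ^+ 2 * (pairb + 1))) + N%:R ^+ 3 * lam ^+ 4 +
   64 * (2 * q)%:R ^+ 2 * N%:R / lam ^+ 2 + (2 * q)%:R ^+ 3 / lam ^+ 4) <= Vrem.

(** Induction on the blocks: the bounds for [t] make the squares of the normalized remainder sum to
    at most [Vrem], so outside [rem_bad] the remainder itself sums to at most [1 / (2 * q)]. They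
    are needed for sets with up to two more levels, for which the term [2 * t] leaves room. *)
Lemma Psi_le_Bound t (X Z : {set node n}) w : ~~ row_bad w -> ~~ col_bad w -> ~~ rem_bad w ->
  (t <= q)%N -> (#|X| + #|Z| + 2 * t <= 2 * q)%N ->
  `|Psi t X Z w| <= lam ^+ #|Z| * Bound t w.
Proof.
move=> /existsPn hr /existsPn hc /existsPn hm.
elim: t X Z => [|t IH] X Z tq XZ.
  rewrite /= /Bound /Weight big_ord0 expr0 !mulr1.
  have [->|] := eqVneq Z finset.set0; first by rewrite cards0 expr0 normr1.
  by rewrite normr0 exprn_ge0// ltW.
have row_pairs j j' : j != j' ->
    `|\sum_(i | blk t i) rowf f i j w * rowf f i j' w| <= pairb.
  rewrite -(inj_eq val_inj)/=; case: ltngtP => // jj' _.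
    by have := hr (Ordinal tq, j, j'); rewrite /= jj'/= -leNgt.
  have := hr (Ordinal tq, j', j); rewrite /= jj'/= -leNgt.
  by under eq_bigr do rewrite mulrC.
have col_pairs j j' : j != j' ->
    `|\sum_(i | blk t i) colf f i j w * colf f i j' w| <= pairb.
  rewrite -(inj_eq val_inj)/=; case: ltngtP => // jj' _.
    by have := hc (Ordinal tq, j, j'); rewrite /= jj'/= -leNgt.
  have := hc (Ordinal tq, j', j); rewrite /= jj'/= -leNgt.
  by under eq_bigr do rewrite mulrC.
have cXZ : (#|X| + #|Z| <= 2 * q)%N by apply: leq_trans XZ; apply: leq_addr.
have p0 : 0 <= pairb by rewrite mulr_ge0 ?sqrtr_ge0// ltW.
have B0 := Bound_gt0 t w.
have IH' (X' Z' : {set node n}) : (#|X'| + #|Z'| <= #|X| + #|Z| + 2)%N ->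
     `|Psi t X' Z' w| <= lam ^+ #|Z'| * Bound t w.
  move=> h; apply: IH; first exact: ltnW.
  by apply: leq_trans XZ; rewrite mulnS addnA leq_add2r.
have := remainder_sqr_le hf (ltW rho_gt0) bw_gt0 cXZ lam_gt0 lam_le1 p0 (ltW B0)
  row_pairs col_pairs IH'.
set L := lam ^+ #|Z| * Bound t w.
have L0 : 0 < L by rewrite mulr_gt0// exprn_gt0.
move=> hsq.
have hV : \sum_(i | blk t i) nrem t X Z i w ^+ 2 <= Vrem.
  apply: le_trans remainder_small; rewrite /nrem.
  under eq_bigr do rewrite exprMn.
  rewrite -mulr_suml exprVn ler_pdivrMr ?exprn_gt0//.
  by apply: le_trans hsq _; rewrite mulrAC.
have hS : `|\sum_(i | blk t i) nrem t X Z i w| <= (2 * q%:R)^-1.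
  by have := hm (Ordinal tq, (X, Z)); rewrite /= cXZ hV andTb andbT -leNgt.
rewrite Psi_succ -/(blockF t w).
have -> : \sum_(i | blk t i) remainder f rho bw t X Z i w =
    L * \sum_(i | blk t i) nrem t X Z i w.
  rewrite mulr_sumr; apply: eq_bigr => i _.
  by rewrite /nrem -/L mulrCA divff ?mulr1// gt_eqF.
apply: le_trans (ler_normD _ _) _; rewrite normrM [`|L * _|]normrM (gtr0_norm L0).
have h1 : `|1 + rho * blockF t w| <= weight t w by rewrite /weight le_max lexx.
have -> : lam ^+ #|Z| * Bound t.+1 w = L * (weight t w + weight t w / q%:R).
  rewrite /L /Bound /Weight big_ord_recr/= exprS; ring.
rewrite mulrDr lerD//.
  rewrite [L * _]mulrC; apply: ler_pM => //.
  exact: IH' (leq_addr 2 _).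
rewrite ler_wpM2l ?(ltW L0)//; apply: le_trans hS _.
by rewrite invfM ler_wpM2r ?invr_ge0 ?(ltW qR)// -div1r weight_ge.
Qed.

Lemma Psi_final_le w : ~~ row_bad w -> ~~ col_bad w -> ~~ rem_bad w ->
  `|Psi q finset.set0 finset.set0 w| <= expR 1 * Weight q w.
Proof.
move=> h1 h2 h3; apply: le_trans (Psi_le_Bound h1 h2 h3 _ _) _ => //.
  by rewrite !cards0.
rewrite cards0 expr0 mul1r ler_wpM2r ?(ltW (Weight_gt0 _ _))//.
Qed.

Hypothesis lN : (0 < l <= N)%N.
Hypotheses (width_large : 12 * dl ^+ 4 <= bw%:R)
  (scale_large : 12 * dl ^+ 5 <= Num.sqrt l%:R) (scale_small : 6 * l%:R ^+ 2 * dl ^+ 2 <= N%:R).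

Local Notation sup := (1 + rho * N%:R ^+ 2).
Local Notation V := (3 * N%:R * bw%:R : R).
Local Notation sq_bad t := (fun w => V < \sum_(i | blk t i) (\sum_j rowf f i j w) ^+ 2).

Let rho0 := ltW rho_gt0.

Let sup_ge1 : 1 <= sup.
Proof. by rewrite lerDl mulr_ge0// sqr_ge0. Qed.

Let blockF_le t w : `|blockF t w| <= N%:R ^+ 2.
Proof.
have := @sum_f_le R n f hf (blk t) (fun _ _ _ => 1) 1 w ler01.
rewrite mulr1 => h; apply: le_trans (h _) => [|i j k]; last by rewrite normr1.
rewrite le_eqVlt; apply/orP; left; apply/eqP; congr `|_|.
by apply: eq_bigr => i _; do 2 apply: eq_bigr => ? _; rewrite mulr1.
Qed.

Let weight_le t w : weight t w <= sup.
Proof.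
rewrite /weight ge_max; apply/andP; split; last by have := sup_ge1; lra.
apply: le_trans (ler_normD _ _) _; rewrite normr1 lerD2l normrM ger0_norm//.
by rewrite ler_wpM2l.
Qed.

Lemma Weight_le t w : (t <= q)%N -> Weight t w <= sup ^+ q.
Proof.
move=> tq; apply: (@le_trans _ _ (sup ^+ t)).
  rewrite -[X in _ ^+ X]card_ord -prodr_const; apply: ler_prod => s _.
  by rewrite weight_le andbT; apply: le_trans (weight_ge _ _).
exact: ler_weXn2l.
Qed.

(** While [|rho * blockF t| <= 1/2] the weight is exactly [1 + rho * blockF t], whose linear part
    has mean zero against [Weight t]. A larger value is either an Azuma event, whose probability can
    be weighted by [Weight t], or [sq_bad]. The latter is controlled by martingales in the other
    coordinates, on whose digits [Weight t] depends as well, so there the trivial bound on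
    [Weight t] is used. *)
Lemma mean_Weight_succ t : (t < q)%N ->
  mean (Weight t.+1) <= mean (Weight t) *
     (1 + 4 * rho * N%:R ^+ 2 * expR (- (96 * rho ^+ 2 * N%:R * bw%:R)^-1)) +
   2 * rho * N%:R ^+ 2 * sup ^+ q * ((N%:R ^+ 2 + N%:R ^+ 3 + 1) * eps).
Proof.
move=> tq.
pose m : R := (2 * rho)^-1.
have m0 : 0 < m by rewrite invr_gt0 mulr_gt0.
have V0 : 0 < V by rewrite !mulr_gt0// ltr0n.
pose A w : bool := (m < `|blockF t w|) && (\sum_(i | blk t i) (\sum_j rowf f i j w) ^+ 2 <= V).
have hA : mean (fun w => Weight t w * (A w)%:R) <=
    2 * mean (Weight t) * expR (- (m ^+ 2 / (8 * V))).
  apply: (@mean_azuma R N c0 (blk t) (fun i w => \sum_j rowf f i j w) (Weight t)) => //.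
  - by move=> i it; apply: level_fresh hf i.
  - by move=> w; apply: ltW (Weight_gt0 _ _).
  - move=> i w it; apply: Weight_inv; by rewrite -(eqP it) leq_trunc_div.
  - exact: ltW.
have hsq : prob (sq_bad t) <= (N%:R ^+ 2 + N%:R ^+ 3 + 1) * eps.
  case/andP: lN => l0 lN'.
  by apply: (@block_second_moment R n f hf (blk t) bw l dl) => //; apply: card_div.
have pw w : Weight t.+1 w <= Weight t w + rho * (Weight t w * blockF t w) +
    2 * rho * N%:R ^+ 2 * (Weight t w * (A w)%:R) +
    2 * rho * N%:R ^+ 2 * sup ^+ q * (sq_bad t w)%:R.
  have W0 := Weight_gt0 t w.
  have c0' : 0 <= 2 * rho * N%:R ^+ 2 by rewrite !mulr_ge0// sqr_ge0.
  have cs : 0 <= 2 * rho * N%:R ^+ 2 * sup ^+ q.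
    by rewrite mulr_ge0// exprn_ge0// (le_trans ler01).
  have -> : Weight t.+1 w = Weight t w * weight t w by rewrite /Weight big_ord_recr.
  have [Fm|Fm] := leP `|blockF t w| m.
    have -> : weight t w = 1 + rho * blockF t w.
      have : `|rho * blockF t w| <= 1 / 2.
        rewrite normrM gtr0_norm//; apply: le_trans (ler_wpM2l rho0 Fm) _.
        by rewrite /m invfM mulrCA divff ?mulr1 ?div1r// gt_eqF.
      rewrite ler_norml => /andP[h1 h2].
      rewrite /weight ger0_norm; last by lra.
      by rewrite max_l//; lra.
    have t1 : 0 <= 2 * rho * N%:R ^+ 2 * (Weight t w * (A w)%:R).
      by rewrite mulr_ge0// mulr_ge0// ltW.
    have t2 : 0 <= 2 * rho * N%:R ^+ 2 * sup ^+ q * (sq_bad t w)%:R by rewrite mulr_ge0.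
    move: t1 t2; lra.
  have wle : weight t w <= 1 + rho * blockF t w + 2 * rho * N%:R ^+ 2.
    have Fb := blockF_le t w.
    have h3 : rho * `|blockF t w| <= rho * N%:R ^+ 2 by rewrite ler_wpM2l.
    have h4 : 1 / 2 < rho * `|blockF t w|.
      apply: (@le_lt_trans _ _ (rho * m)); last by rewrite ltr_pM2l.
      by rewrite /m invfM mulrCA divff ?mulr1 ?div1r// gt_eqF.
    have h5 : - (rho * `|blockF t w|) <= rho * blockF t w.
      by rewrite -mulrN ler_wpM2l// lerNl -normrN ler_norm.
    rewrite /weight ge_max; apply/andP; split; last by lra.
    have h6 : rho * blockF t w <= rho * `|blockF t w| by rewrite ler_wpM2l// ler_norm.
    rewrite ler_norml; apply/andP; split; lra.
  have := ler_wpM2l (ltW W0) wle.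
  have AE : A w = ~~ sq_bad t w by rewrite /A Fm/= leNgt.
  rewrite AE; case: (sq_bad t w) => /=.
    have Wl := Weight_le w (ltnW tq).
    have := ler_wpM2l c0' Wl; lra.
  rewrite mulr1 mulr0; lra.
apply: le_trans (ler_mean pw) _; rewrite !meanD !meanZ.
have -> : mean (fun w => Weight t w * blockF t w) = 0.
  have -> : mean (fun w => Weight t w * blockF t w) =
      \sum_(i | blk t i) mean (fun w => (\sum_j \sum_k f i j k w) * Weight t w).
    rewrite -mean_sum; apply: eq_mean => w.
    by rewrite -mulr_suml mulrC.
  rewrite big1// => i it; apply: (@mean_odd _ _ (c0, i)).
  apply: (fresh_mul (level_fresh hf i) _).1.
  by apply: (@inv_le _ _ _ (t * bw)) (@Weight_inv t); rewrite -(eqP it) leq_trunc_div.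
rewrite mulr0 addr0.
have c0' : 0 <= 2 * rho * N%:R ^+ 2 by rewrite !mulr_ge0// sqr_ge0.
have cs : 0 <= 2 * rho * N%:R ^+ 2 * sup ^+ q.
  by rewrite mulr_ge0// exprn_ge0// (le_trans ler01).
apply: lerD; last exact: ler_wpM2l.
have eE : m ^+ 2 / (8 * V) = (96 * rho ^+ 2 * N%:R * bw%:R)^-1.
  rewrite /m; field; rewrite !lt0r_neq0// ltr0n//.
have := ler_wpM2l c0' hA; rewrite eE; lra.
Qed.

Hypothesis tail_small : 4 * rho * N%:R ^+ 2 * expR (- (96 * rho ^+ 2 * N%:R * bw%:R)^-1) <= q%:R^-1.
Hypothesis exceptional_small :
  2 * rho * N%:R ^+ 2 * sup ^+ q * ((N%:R ^+ 2 + N%:R ^+ 3 + 1) * eps) <= q%:R^-1.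

(** Adding 1 turns the recursion [x' <= x * (1 + 1/q) + 1/q] into a purely multiplicative one, and
    [q] steps cost at most a factor [expR 1]. *)
Lemma mean_Weight_le : mean (Weight q) <= 2 * expR 1.
Proof.
have H t : (t <= q)%N -> mean (Weight t) + 1 <= 2 * (1 + q%:R^-1) ^+ t.
  elim: t => [|t IH] tq.
    rewrite expr0 mulr1 [X in X + _](_ : _ = 1); first by lra.
    by rewrite -[RHS](@mean_cst R N 1); apply: eq_mean => w; rewrite /Weight big_ord0.
  have M0 : 0 <= mean (Weight t) by apply: mean_ge0 => w; apply: ltW (Weight_gt0 _ _).
  have := mean_Weight_succ tq.
  have := ler_wpM2l M0 tail_small; have := IH (ltnW tq).
  move: exceptional_small; set th := 4 * _ * _ * _; set ka := 2 * _ * _ * _ * _.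
  set u := (1 + _) ^+ t; rewrite exprS -/u => hk hu ht hs.
  have qi : 0 <= q%:R^-1 :> R by rewrite invr_ge0 ltW.
  have := ler_wpM2l (addr_ge0 ler01 qi) hu.
  lra.
have := H q (leqnn q).
have := one_plus_inv_exp; lra.
Qed.

Hypothesis bad_small : sup ^+ q *
  ((2 * (q%:R * N%:R ^+ 2) + q%:R * (2 * N%:R + 1) ^+ (4 * q)) * eps) <= 1.

Lemma mean_norm_Psi_le :
  mean (fun w => `|Psi q finset.set0 finset.set0 w|) <= 2 * expR 1 ^+ 2 + 1.
Proof.
pose bad w := (row_bad w || col_bad w) || rem_bad w.
apply: (@le_trans _ _ (mean (fun w => expR 1 * Weight q w + sup ^+ q * (bad w)%:R))).
  apply: ler_mean => w; rewrite /bad.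
  have W0 : 0 <= expR 1 * Weight q w.
    by rewrite mulr_ge0 ?expR_ge0// ltW// Weight_gt0.
  case: (boolP (_ || _)) => h.
    rewrite mulr1; apply: le_trans (Psi_sup hf bw rho0 _ _ _ _) _.
    by rewrite lerDr.
  move: h; rewrite !negb_or => /andP[/andP[h1 h2] h3].
  by rewrite mulr0 addr0; apply: Psi_final_le.
rewrite meanD !meanZ lerD//.
  have := ler_wpM2l (expR_ge0 (1 : R)) mean_Weight_le; lra.
apply: le_trans bad_small; rewrite ler_wpM2l ?exprn_ge0 ?(le_trans ler01)//.
apply: le_trans (prob_or _ _) _; rewrite mulrDl lerD ?prob_rem_bad//.
apply: le_trans (prob_or _ _) _.
have := prob_row_bad; have := prob_col_bad; lra.
Qed.

End L1Bound.

(** * Orthogonality *)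

Section Orthogonality.
Variables (R : realType) (n : nat).
Local Notation N := n.+1.
Implicit Types (i j k A B C : 'I_N) (F G : cube N -> R).

Definition fresh3 i j k F := [/\ fresh c0 i F, fresh c1 j F & fresh c2 k F].

(** The product is odd in the finer of the two digits. *)
Lemma mean_mul_fresh c i j F G : fresh c i F -> fresh c j G -> i != j ->
  mean (fun w => F w * G w) = 0.
Proof.
move=> Fi Gj; rewrite -(inj_eq val_inj)/=; case: ltngtP => // ij _.
  have -> : mean (fun w => F w * G w) = mean (fun w => G w * F w).
    by apply: eq_mean => w; rewrite mulrC.
  by apply: (@mean_odd _ _ (c, j)); apply: (fresh_mul Gj (inv_le ij (fresh_inv Fi))).1.
by apply: (@mean_odd _ _ (c, i)); apply: (fresh_mul Fi (inv_le ij (fresh_inv Gj))).1.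
Qed.

Lemma mean_mul_fresh3 i j k A B C F G : fresh3 i j k F -> fresh3 A B C G ->
  (i, j, k) != (A, B, C) -> mean (fun w => F w * G w) = 0.
Proof.
move=> [F0 F1 F2] [G0 G1 G2]; rewrite -pair_eqE /pair_eq/= -pair_eqE /pair_eq/=.
rewrite !negb_and => /orP[/orP[]|] h.
- exact: mean_mul_fresh F0 G0 h.
- exact: mean_mul_fresh F1 G1 h.
- exact: mean_mul_fresh F2 G2 h.
Qed.

Definition maxo i j : 'I_N := if (i < j)%N then j else i.

Lemma fresh_mul_max c i j F G : fresh c i F -> fresh c j G -> i != j ->
  fresh c (maxo i j) (fun w => F w * G w).
Proof.
move=> Fi Gj; rewrite -(inj_eq val_inj)/= /maxo; case: ltngtP => // ij _.
  apply: (@eq_fresh _ _ _ _ (fun w => G w * F w)) => [w|]; first by rewrite mulrC.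
  exact: (fresh_mul Gj (inv_le ij (fresh_inv Fi))).
exact: (fresh_mul Fi (inv_le ij (fresh_inv Gj))).
Qed.

Variable f : 'I_N -> 'I_N -> 'I_N -> cube N -> R.
Hypothesis hf : haar_family f.
Variables (rho : R) (bw q : nat).
Hypotheses (bw_gt0 : (0 < bw)%N) (qbw : (N <= q * bw)%N).
Variable g : 'I_N -> 'I_N -> 'I_N -> cube N -> R.
Hypotheses (g_supp : forall i j k w, g i j k w != 0 -> (i + j + k = n)%N)
  (g_fresh : forall i j k, fresh3 i j k (g i j k)).

Local Notation Psi := (Psi f rho bw).

Let f_fresh i j k : fresh3 i j k (f i j k).
Proof. by split; [apply: fam_fresh0|apply: fam_fresh1|apply: fam_fresh2]. Qed.

Let mean0 F : F =1 (fun=> 0) -> mean F = 0.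
Proof. by move=> F0; rewrite -[RHS](@mean_cst R N 0); apply: eq_mean. Qed.

Let f_eq0 i j k w : (i + j + k != n)%N -> f i j k w = 0.
Proof. by move=> h; apply/eqP; apply: contraNT h => /(fam_supp hf)->. Qed.

Let g_eq0 i j k w : (i + j + k != n)%N -> g i j k w = 0.
Proof. by move=> h; apply/eqP; apply: contraNT h => /g_supp->. Qed.

Lemma mean_fresh3_big A B C F i j k : fresh3 A B C F -> (n < A + B + C)%N ->
  mean (fun w => F w * g i j k w) = 0.
Proof.
move=> hF big; have [ijk|ijk] := eqVneq (i + j + k)%N n; last first.
  by apply: mean0 => w; rewrite g_eq0// mulr0.
apply: mean_mul_fresh3 hF (g_fresh i j k) _; apply/eqP => -[eA eB eC].
by move: big; rewrite eA eB eC ijk ltnn.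
Qed.

(** [F] collects the factors already taken from later blocks; with nothing required in [Z], one more
    block is peeled off. *)
Let mean_Psi_succ t (X : {set node n}) F G : mean (fun w => F w * Psi t.+1 X finset.set0 w * G w) =
  mean (fun w => F w * Psi t X finset.set0 w * G w) +
  rho * \sum_(i < N | (i %/ bw == t)%N) \sum_j \sum_k (avoids X j k)%:R *
    mean (fun w => (F w * f i j k w) * Psi t (X :|: edge j k) finset.set0 w * G w).
Proof.
have -> : \sum_(i < N | (i %/ bw == t)%N) \sum_j \sum_k (avoids X j k)%:R *
    mean (fun w => (F w * f i j k w) * Psi t (X :|: edge j k) finset.set0 w * G w) =
  mean (fun w => F w * (\sum_(i < N | (i %/ bw == t)%N) \sum_j \sum_k
      f i j k w * ((avoids X j k)%:R * Psi t (X :|: edge j k) finset.set0 w)) * G w).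
  under eq_bigr do under eq_bigr do under eq_bigr do rewrite -meanZ.
  under eq_bigr do under eq_bigr do rewrite -mean_sum.
  under eq_bigr do rewrite -mean_sum.
  rewrite -mean_sum; apply: eq_mean => w.
  rewrite mulr_sumr mulr_suml; apply: eq_bigr => i _.
  rewrite mulr_sumr mulr_suml; apply: eq_bigr => j _.
  rewrite mulr_sumr mulr_suml; apply: eq_bigr => k _; ring.
rewrite -meanZ -meanD; apply: eq_mean => w /=.
have -> : \sum_(i < N | (i %/ bw == t)%N) \sum_j \sum_k f i j k w *
      ((avoids X j k)%:R * Psi t (X :|: edge j k) (finset.set0 :\: edge j k) w) =
    \sum_(i < N | (i %/ bw == t)%N) \sum_j \sum_k f i j k w *
      ((avoids X j k)%:R * Psi t (X :|: edge j k) finset.set0 w).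
  by apply: eq_bigr => i _; do 2 apply: eq_bigr => ? _; rewrite finset.set0D.
ring.
Qed.

(* [F] is a product of [f]s with finest levels [A], [B], [C]. Each further
   factor keeps the levels distinct and makes their sum exceed [n]. *)
Lemma mean_fresh3_Psi t (X : {set node n}) A B C F i j k : (t * bw <= A)%N ->
  inl B \in X -> inr C \in X -> (n <= A + B + C)%N -> fresh3 A B C F ->
  mean (fun w => F w * Psi t X finset.set0 w * g i j k w) =
  mean (fun w => F w * g i j k w).
Proof.
elim: t X A B C F => [|t IH] X A B C F tA BX CX nABC hF.
  by apply: eq_mean => w; rewrite /= eqxx mulr1.
have tA' : (t * bw <= A)%N by apply: leq_trans tA; rewrite leq_mul2r leqnSn orbT.
rewrite mean_Psi_succ (IH _ A B C)// [X in _ + rho * X](_ : _ = 0) ?mulr0 ?addr0//.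
apply: big1 => i' /eqP it; apply: big1 => j' _; apply: big1 => k' _.
case: (boolP (avoids X j' k')) => [/andP[jX kX]|_]; last by rewrite mul0r.
rewrite mul1r; have [s|s] := eqVneq (i' + j' + k')%N n; last first.
  by apply: mean0 => w; rewrite f_eq0// mulr0 !mul0r.
have iA : (i' < A)%N by apply: leq_trans tA; rewrite -it ltn_ceil.
have jB : B != j' by apply: contraNneq jX => <-.
have kC : C != k' by apply: contraNneq kX => <-.
case: hF => F0 F1 F2; case: (f_fresh i' j' k') => f0 f1 f2.
have h3 : fresh3 A (maxo B j') (maxo C k') (fun w => F w * f i' j' k' w).
  split; [|exact: fresh_mul_max|exact: fresh_mul_max].
  exact: (fresh_mul F0 (inv_le iA (fresh_inv f0))).
have big : (n < A + maxo B j' + maxo C k')%N.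
  have : (j' <= maxo B j')%N by rewrite /maxo; case: ltnP.
  have : (k' <= maxo C k')%N by rewrite /maxo; case: ltnP.
  by move: s iA; clear; lia.
rewrite (IH _ _ _ _ _ tA' _ _ (ltnW big) h3).
- exact: mean_fresh3_big h3 big.
- by rewrite finset.in_setU in_edge /maxo; case: ifP => _; rewrite ?eqxx ?orbT ?BX.
- by rewrite finset.in_setU in_edge /maxo; case: ifP => _; rewrite ?eqxx ?orbT ?CX.
Qed.

(** The constant term 1 of [Psi] has mean zero against [g], and [mean_fresh3_Psi] removes the
    products of several factors. In the linear part only the level [(i, j, k)] remains, and [qbw]
    ensures that some block contains it. *)
Lemma mean_Psi_g i j k :
  mean (fun w => Psi q finset.set0 finset.set0 w * g i j k w) =
  rho * mean (fun w => f i j k w * g i j k w).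
Proof.
have H t : mean (fun w => 1 * Psi t finset.set0 finset.set0 w * g i j k w) =
    rho * \sum_(i' < N | (i' %/ bw < t)%N) \sum_j' \sum_k'
      mean (fun w => f i' j' k' w * g i j k w).
  elim: t => [|t IH].
    rewrite big_pred0// mulr0; apply: (@mean_odd _ _ (c0, i)) => w /=.
    by rewrite eqxx !mul1r; case: (g_fresh i j k) => -[].
  rewrite mean_Psi_succ IH -mulrDr; congr (_ * _).
  rewrite [RHS](bigID (fun i' : 'I_N => (i' %/ bw < t)%N))/=; congr (_ + _).
    by apply: eq_bigl => i'; rewrite ltnS; case: ltngtP.
  apply: eq_big => [i'|i' /eqP it]; first by rewrite ltnS; case: ltngtP.
  apply: eq_bigr => j' _; apply: eq_bigr => k' _.
  rewrite /avoids !finset.in_set0 mul1r.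
  have [s|s] := eqVneq (i' + j' + k')%N n; last first.
    rewrite !mean0// => w; first by rewrite f_eq0// mul0r.
    by rewrite f_eq0// mulr0 !mul0r.
  have -> : mean (fun w => 1 * f i' j' k' w *
      Psi t (finset.set0 :|: edge j' k') finset.set0 w * g i j k w) =
    mean (fun w => f i' j' k' w *
      Psi t (finset.set0 :|: edge j' k') finset.set0 w * g i j k w).
    by apply: eq_mean => w; rewrite mul1r.
  apply: (@mean_fresh3_Psi t _ i' j' k') => //.
  - by rewrite -it leq_trunc_div.
  - by rewrite finset.in_setU in_edge eqxx orbT.
  - by rewrite finset.in_setU in_edge eqxx !orbT.
  - by rewrite s.
have -> : mean (fun w => Psi q finset.set0 finset.set0 w * g i j k w) =
    mean (fun w => 1 * Psi q finset.set0 finset.set0 w * g i j k w).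
  by apply: eq_mean => w; rewrite mul1r.
rewrite H; congr (_ * _).
have ne (i' j' k' : 'I_N) : (i', j', k') != (i, j, k) ->
    mean (fun w => f i' j' k' w * g i j k w) = 0.
  exact: mean_mul_fresh3 (f_fresh _ _ _) (g_fresh _ _ _).
rewrite (bigD1 i)/=; last by rewrite ltn_divLR// (leq_trans (ltn_ord i)).
rewrite (bigD1 j)//= (bigD1 k)//= big1 ?addr0; last first.
  by move=> k' kk; apply: ne; apply: contraNneq kk => -[->].
rewrite big1 ?addr0; last first.
  by move=> j' jj; apply: big1 => k' _; apply: ne; apply: contraNneq jj => -[-> _].
rewrite big1 ?addr0// => i' /andP[_ ii].
apply: big1 => j' _; apply: big1 => k' _; apply: ne.
by apply: contraNneq ii => -[-> _ _].
Qed.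

(** Testing the Haar sum against [Psi]: by the choice of signs the linear part returns the absolute
    values. *)
Lemma small_ball_duality (K S : R) : 0 <= S ->
  (forall i j k w, f i j k w * g i j k w = `|g i j k w|) ->
  mean (fun w => `|Psi q finset.set0 finset.set0 w|) <= K ->
  (forall w, `|\sum_i \sum_j \sum_k g i j k w| <= S) ->
  rho * \sum_i \sum_j \sum_k mean (fun w => `|g i j k w|) <= K * S.
Proof.
move=> S0 fg PsiK gS.
have -> : rho * \sum_i \sum_j \sum_k mean (fun w => `|g i j k w|) =
    mean (fun w => Psi q finset.set0 finset.set0 w * \sum_i \sum_j \sum_k g i j k w).
  rewrite mulr_sumr.
  have -> : mean (fun w => Psi q finset.set0 finset.set0 w * \sum_i \sum_j \sum_k g i j k w) =
     mean (fun w => \sum_i \sum_j \sum_k Psi q finset.set0 finset.set0 w * g i j k w).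
    apply: eq_mean => w; rewrite mulr_sumr; apply: eq_bigr => i _.
    by rewrite mulr_sumr; apply: eq_bigr => j _; rewrite mulr_sumr.
  rewrite mean_sum; apply: eq_bigr => i _; rewrite mean_sum mulr_sumr.
  apply: eq_bigr => j _; rewrite mean_sum mulr_sumr; apply: eq_bigr => k _.
  rewrite mean_Psi_g; congr (_ * _); apply: eq_mean => w; exact/esym/fg.
apply: le_trans (ler_wpM2r S0 PsiK); rewrite mulrC -meanZ; apply: ler_mean => w.
apply: le_trans (ler_norm _) _; rewrite normrM mulrC.
by rewrite ler_wpM2r.
Qed.

End Orthogonality.

(** * Choice of the parameters *)

Section NumericChoice.
Variable R : realType.
Implicit Types x y u v : R.

(** Used to bound the factors in the conditions on the parameters by exponentials of polynomials in
    [m], so that only exponents need comparing. *)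
Lemma mul_expR_le x y u v : 0 <= x -> 0 <= y -> x <= expR u -> y <= expR v ->
  x * y <= expR (u + v).
Proof. by move=> x0 y0 xu yv; rewrite expRD ler_pM. Qed.

Lemma add_expR_le x y u v : 0 <= u -> 1 <= v -> x <= expR u -> y <= expR u ->
  x + y <= expR (u + v).
Proof.
move=> u0 v1 xu yu; rewrite expRD; apply: le_trans (lerD xu yu) _.
rewrite -mulr2n -[leLHS]mulr_natr ler_wpM2l ?expR_ge0//.
by apply: le_trans (expR_ge1Dx v); lra.
Qed.

Lemma exprn_expR_le x u (k : nat) : 0 <= x -> x <= expR u -> x ^+ k <= expR (k%:R * u).
Proof. by move=> x0 xu; rewrite expRM_natl lerXn2r// nnegrE expR_ge0. Qed.

Lemma le_expR x : x <= expR x.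
Proof. by apply: le_trans (expR_ge1Dx x); rewrite lerDr. Qed.

(** Here [a] is [m] and [s] is the square root of [N]. After cancellation the left side has four
    terms, each allotted a quarter of the right side. The last two decay in [a] alone; the first two
    need [s] above about [a ^+ 45], which accounts for the exponent 100 in the choice of [m]. *)
Lemma remainder_small_num (a s : R) : 1000 * 1000 <= a -> a ^+ 50 <= s ->
  5 * (a / s ^+ 2) ^+ 2 *
  (2 * ((a ^+ 13 / s) ^+ 2 * ((s ^+ 2) ^+ 2 * (a ^+ 3 * s + 1))) +
   (s ^+ 2) ^+ 3 * (a ^+ 13 / s) ^+ 4 +
   64 * (2 * a ^+ 4) ^+ 2 * s ^+ 2 / (a ^+ 13 / s) ^+ 2 + (2 * a ^+ 4) ^+ 3 / (a ^+ 13 / s) ^+ 4)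
  <= ((2 * a ^+ 4 * a ^+ 3)^-1) ^+ 2.
Proof.
move=> a_big as50.
have a1 : 1 <= a by apply: le_trans a_big; lra.
have a0 : 0 < a by exact: lt_le_trans a1.
have s0 : 0 < s by apply: lt_le_trans as50; rewrite exprn_gt0.
have a_num (k : R) : k <= 1000 * 1000 -> k <= a by move=> /le_trans; apply.
have a100 : a ^+ 100 <= s ^+ 2.
  by rewrite (exprM _ 50 2) lerXn2r// nnegrE ?exprn_ge0// ltW.
have -> : 5 * (a / s ^+ 2) ^+ 2 *
  (2 * ((a ^+ 13 / s) ^+ 2 * ((s ^+ 2) ^+ 2 * (a ^+ 3 * s + 1))) +
   (s ^+ 2) ^+ 3 * (a ^+ 13 / s) ^+ 4 +
   64 * (2 * a ^+ 4) ^+ 2 * s ^+ 2 / (a ^+ 13 / s) ^+ 2 + (2 * a ^+ 4) ^+ 3 / (a ^+ 13 / s) ^+ 4) =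
  10 * a ^+ 28 * (a ^+ 3 * s + 1) / s ^+ 2 + 5 * a ^+ 54 / s ^+ 2 + 1280 / a ^+ 16 +
   40 / a ^+ 38.
  by field; rewrite !lt0r_neq0.
have -> : ((2 * a ^+ 4 * a ^+ 3)^-1) ^+ 2 = (4 * a ^+ 14)^-1.
  by field; rewrite !lt0r_neq0.
have a14 : 0 < a ^+ 14 by rewrite exprn_gt0.
have t0 : (4 * a ^+ 14)^-1 = (16 * a ^+ 14)^-1 + (16 * a ^+ 14)^-1 + (16 * a ^+ 14)^-1 +
   (16 * a ^+ 14)^-1 by field; rewrite lt0r_neq0.
have p16 : 0 < 16 * a ^+ 14 by rewrite mulr_gt0.
have pn (k : nat) : 0 <= a ^+ k by rewrite exprn_ge0// ltW.
rewrite t0; apply: lerD; first apply: lerD; first apply: lerD.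
- rewrite ler_pdivrMr ?exprn_gt0// [leRHS]mulrC ler_pdivlMr//.
  have h : 1 <= a ^+ 3 * s.
    by rewrite mulr_ege1 ?exprn_ege1//; apply: le_trans as50; rewrite exprn_ege1.
  apply: (@le_trans _ _ (320 * a ^+ 45 * s)).
    have -> : 320 * a ^+ 45 * s = 10 * a ^+ 28 * (2 * (a ^+ 3 * s)) * (16 * a ^+ 14) by ring.
    rewrite ler_wpM2r ?(ltW p16)// ler_wpM2l ?(mulr_ge0 _ (pn 28))//.
    by rewrite mulr_natl mulr2n lerD2l.
  rewrite expr2 ler_wpM2r ?(ltW s0)//; apply: le_trans as50.
  rewrite [leRHS](exprD _ 5 45) ler_wpM2r//.
  by apply: le_trans (_ : a <= _); [apply: a_num; lra|rewrite ler_eXnr].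
- rewrite ler_pdivrMr ?exprn_gt0// [leRHS]mulrC ler_pdivlMr//.
  apply: le_trans a100; have -> : 5 * a ^+ 54 * (16 * a ^+ 14) = 80 * a ^+ 68 by ring.
  rewrite [leRHS](exprD _ 32 68) ler_wpM2r//.
  by apply: le_trans (_ : a <= _); [apply: a_num; lra|rewrite ler_eXnr].
- rewrite ler_pdivrMr ?exprn_gt0// [leRHS]mulrC ler_pdivlMr//.
  have -> : 1280 * (16 * a ^+ 14) = 160 * 128 * a ^+ 14 by ring.
  rewrite [leRHS](exprD _ 2 14) ler_wpM2r//.
  by apply: le_trans (_ : a <= _); [apply: a_num; lra|rewrite ler_eXnr].
- rewrite ler_pdivrMr ?exprn_gt0// [leRHS]mulrC ler_pdivlMr//.
  have -> : 40 * (16 * a ^+ 14) = 640 * a ^+ 14 by ring.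
  rewrite [leRHS](exprD _ 24 14) ler_wpM2r//.
  by apply: le_trans (_ : a <= _); [apply: a_num; lra|rewrite ler_eXnr].
Qed.

Variables (n m : nat).
Local Notation N := n.+1.
Local Notation a := (m%:R : R).
Local Notation s := (Num.sqrt N%:R : R).
Hypotheses (a_big : 1000 * 1000 <= a) (mN : (m ^ 100 <= N)%N) (Nm : (N <= m.+1 ^ 100)%N).

Let a1 : 1 <= a. Proof. by apply: le_trans a_big; lra. Qed.
Let a0 : 0 < a. Proof. exact: lt_le_trans a1. Qed.
Let N0 : 0 < N%:R :> R. Proof. by rewrite ltr0n. Qed.
Let s0 : 0 < s. Proof. by rewrite sqrtr_gt0. Qed.
Let sN : s ^+ 2 = N%:R. Proof. by rewrite sqr_sqrtr// ltW. Qed.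
Let m0 : (0 < m)%N. Proof. by rewrite -(ltr_nat R). Qed.

Let aN : a ^+ 100 <= N%:R. Proof. by rewrite -natrX ler_nat. Qed.

Let as50 : a ^+ 50 <= s.
Proof.
rewrite -(@ler_pXn2r _ 2)// ?nnegrE ?exprn_ge0 ?(ltW a0) ?(ltW s0)//.
by rewrite sN -exprM.
Qed.

Let apow (i j : nat) : (i <= j)%N -> a ^+ i <= a ^+ j.
Proof. exact: ler_weXn2l. Qed.

Let N_exp : N%:R <= expR (100 * a).
Proof.
apply: (@le_trans _ _ (m.+1%:R ^+ 100)); first by rewrite -natrX ler_nat.
apply: exprn_expR_le => //; apply: le_trans (expR_ge1Dx a).
by rewrite -natr1 addrC.
Qed.

(* With [m] about [N] to the power 1/100: [rho] gains the factor [m] over the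
   trivial [N^-1]; [rho ^+ 2 * N * width], about [m ^- 2], makes
   [rho * blockF] exceed [1 / 2] with probability [expR (- m ^+ 2)] only;
   [dl ^+ 2 = m ^+ 6] beats the entropy [blocks * ln N] of the union bound. *)
Definition blocks := (m ^ 4)%N.
Definition width := (N %/ blocks).+1.
Definition rho : R := a / N%:R.
Definition dl : R := a ^+ 3.
(** The pairs meeting [X] or [Z] contribute order [m ^- 16] to a budget of order [m ^- 14]; 13 is
    the least integer exponent for which this works. *)
Definition lam : R := a ^+ 13 / s.
(** Its square root [m ^ 16] has to exceed [12 * dl ^+ 5], that is [12 * m ^ 15]. *)
Definition scale := (m ^ 32)%N.

Let qE : blocks%:R = a ^+ 4 :> R. Proof. by rewrite natrX. Qed.
Let q0 : (0 < blocks)%N. Proof. by rewrite expn_gt0 m0. Qed.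

Lemma blocks_width : (N <= blocks * width)%N.
Proof. by rewrite mulnC ltnW// ltn_ceil. Qed.

Let width_ge : N%:R / a ^+ 4 <= width%:R.
Proof.
rewrite ler_pdivrMr ?exprn_gt0// -qE -natrM ler_nat mulnC; exact: blocks_width.
Qed.

Let width_le : width%:R <= 2 * (N%:R / a ^+ 4).
Proof.
rewrite mulrA ler_pdivlMr ?exprn_gt0// -qE -natrM -natrM ler_nat.
rewrite /width mulSn mul2n -addnn leq_add ?leq_trunc_div//.
by apply: leq_trans mN; rewrite /blocks leq_pexp2l.
Qed.

Let a_num (k : R) : k <= 1000 * 1000 -> k <= a.
Proof. by move=> /le_trans; apply. Qed.

Lemma remainder_small_ok : 5 * rho ^+ 2 *
  (2 * (lam ^+ 2 * (N%:R ^+ 2 * (dl * s + 1))) + N%:R ^+ 3 * lam ^+ 4 +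
   64 * (2 * blocks)%:R ^+ 2 * N%:R / lam ^+ 2 + (2 * blocks)%:R ^+ 3 / lam ^+ 4)
   <= ((2 * blocks%:R * dl)^-1) ^+ 2.
Proof.
by have := remainder_small_num a_big as50; rewrite natrM qE /rho /lam /dl sN.
Qed.

Let rhoN2 : rho * N%:R ^+ 2 = a * N%:R.
Proof. by rewrite /rho; field; exact: lt0r_neq0. Qed.

Let aN_exp : a * N%:R <= expR (101 * a).
Proof.
have -> : 101 * a = a + 100 * a by ring.
by apply: mul_expR_le => //; exact: le_expR.
Qed.

Let a_ge0 : 0 <= a := ltW a0.
Let N_ge0 : 0 <= N%:R :> R := ltW N0.

Let c_exp (k : R) : k <= 1000 * 1000 -> k <= expR a.
Proof. by move=> k6; apply: le_trans (le_expR a); exact: a_num. Qed.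

Let a4_exp : a ^+ 4 <= expR (4 * a).
Proof. exact: exprn_expR_le (le_expR a). Qed.

Lemma tail_small_ok : 4 * rho * N%:R ^+ 2 *
  expR (- (96 * rho ^+ 2 * N%:R * width%:R)^-1) <= blocks%:R^-1.
Proof.
rewrite -[leRHS]div1r ler_pdivlMr; last by rewrite qE exprn_gt0.
have -> : 4 * rho * N%:R ^+ 2 = 4 * (a * N%:R) by rewrite -mulrA rhoN2.
rewrite qE -[leLHS]mulrA.
(* As [width] is at most [2 * N / m ^ 4], the exponent is at least [m ^ 2 / 192], against [106 * m]
   from the other factors. *)
have e1 : expR (- (96 * rho ^+ 2 * N%:R * width%:R)^-1) <= expR (- (a ^+ 2 / 192)).
  rewrite ler_expR lerN2 -[leRHS]div1r ler_pdivlMr; last first.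
    by rewrite !mulr_gt0 ?exprn_gt0 ?divr_gt0// ltr0n.
  have pa : 0 <= 96 * rho ^+ 2 * N%:R by rewrite !mulr_ge0 ?sqr_ge0.
  apply: (@le_trans _ _ (a ^+ 2 / 192 * (96 * rho ^+ 2 * N%:R * (2 * (N%:R / a ^+ 4))))).
    rewrite ler_wpM2l ?divr_ge0 ?sqr_ge0//.
    by apply: ler_wpM2l.
  rewrite /rho le_eqVlt; apply/orP; left; apply/eqP; field; by rewrite !lt0r_neq0.
apply: (@le_trans _ _ (expR (a + 101 * a + (- (a ^+ 2 / 192) + 4 * a)))).
  apply: mul_expR_le; rewrite ?mulr_ge0 ?expR_ge0//.
    by apply: mul_expR_le; rewrite ?mulr_ge0//; apply: c_exp; lra.
  by apply: mul_expR_le; rewrite ?expR_ge0 ?exprn_ge0.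
rewrite -[leRHS]expR0 ler_expR.
have : 1000 * 1000 * a <= a ^+ 2 by rewrite expr2 ler_wpM2r.
move: a0; lra.
Qed.

Let sup_exp : 1 + rho * N%:R ^+ 2 <= expR (102 * a).
Proof.
have -> : 102 * a = 101 * a + a by ring.
rewrite rhoN2; apply: add_expR_le => //.
by apply: le_trans (expR_ge1Dx _); rewrite lerDl mulr_ge0.
Qed.

Let sup_ge0 : 0 <= 1 + rho * N%:R ^+ 2.
Proof. by rewrite rhoN2 addr_ge0// mulr_ge0. Qed.

Let supq_exp : (1 + rho * N%:R ^+ 2) ^+ blocks <= expR (102 * a ^+ 5).
Proof.
apply: le_trans (exprn_expR_le blocks sup_ge0 sup_exp) _.
by rewrite qE ler_expR le_eqVlt; apply/orP; left; apply/eqP; ring.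
Qed.

Let eps_exp : 2 * expR (- (dl ^+ 2 / 8)) <= expR (a + - (a ^+ 6 / 8)).
Proof.
apply: mul_expR_le; rewrite ?expR_ge0//; first by apply: c_exp; lra.
by rewrite /dl -exprM.
Qed.

Let final_num (c d : R) : 0 <= c -> c <= 1000 -> 0 <= d -> d <= 1000 ->
  c * a ^+ 5 + d * a - a ^+ 6 / 8 <= 0.
Proof.
move=> c0 c1 d0' d1.
have a5 : a <= a ^+ 5 by rewrite ler_eXnr.
have a5' : 0 <= a ^+ 5 by rewrite exprn_ge0.
have h : 1000 * 1000 * a ^+ 5 <= a ^+ 6 by rewrite [leRHS]exprS ler_wpM2r.
have h1 : c * a ^+ 5 <= 1000 * a ^+ 5 by rewrite ler_wpM2r.
have h2 : d * a <= 1000 * a ^+ 5 by rewrite ler_pM.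
move: h; lra.
Qed.

Lemma exceptional_small_ok : 2 * rho * N%:R ^+ 2 * (1 + rho * N%:R ^+ 2) ^+ blocks *
  ((N%:R ^+ 2 + N%:R ^+ 3 + 1) * (2 * expR (- (dl ^+ 2 / 8)))) <= blocks%:R^-1.
Proof.
rewrite -[leRHS]div1r ler_pdivlMr; last by rewrite qE exprn_gt0.
have -> : 2 * rho * N%:R ^+ 2 = 2 * (a * N%:R) by rewrite -mulrA rhoN2.
rewrite qE.
have N3 : N%:R ^+ 2 + N%:R ^+ 3 + 1 <= expR (a + 300 * a).
  have N1 : 1 <= N%:R :> R by rewrite ler1n.
  apply: (@le_trans _ _ (3 * N%:R ^+ 3)).
    have : N%:R ^+ 2 <= N%:R ^+ 3 :> R by rewrite ler_weXn2l.
    have : 1 <= N%:R ^+ 3 :> R by rewrite exprn_ege1.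
    lra.
  apply: mul_expR_le; rewrite ?exprn_ge0//; first by apply: c_exp; lra.
  apply: le_trans (exprn_expR_le 3 N_ge0 N_exp) _.
  by rewrite ler_expR mulrA -natrM.
have p3 : 0 <= N%:R ^+ 2 + N%:R ^+ 3 + 1 :> R by rewrite !addr_ge0 ?exprn_ge0.
have pe : 0 <= 2 * expR (- (dl ^+ 2 / 8)) by rewrite mulr_ge0 ?expR_ge0.
have t1 : 2 * (a * N%:R) <= expR (a + 101 * a).
  by apply: mul_expR_le; rewrite ?mulr_ge0//; apply: c_exp; lra.
have p1 : 0 <= 2 * (a * N%:R) by rewrite !mulr_ge0.
have ps : 0 <= (1 + rho * N%:R ^+ 2) ^+ blocks by rewrite exprn_ge0.
have t2 := mul_expR_le p1 ps t1 supq_exp.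
have t3 := mul_expR_le p3 pe N3 eps_exp.
have t4 := mul_expR_le (mulr_ge0 p1 ps) (mulr_ge0 p3 pe) t2 t3.
have pa4 : 0 <= a ^+ 4 by rewrite exprn_ge0.
have t5 := mul_expR_le (mulr_ge0 (mulr_ge0 p1 ps) (mulr_ge0 p3 pe)) pa4 t4 a4_exp.
apply: le_trans t5 _; rewrite -[leRHS]expR0 ler_expR.
have := @final_num 102 408; lra.
Qed.

Lemma bad_small_ok : (1 + rho * N%:R ^+ 2) ^+ blocks *
  ((2 * (blocks%:R * N%:R ^+ 2) + blocks%:R * (2 * N%:R + 1) ^+ (4 * blocks)) *
   (2 * expR (- (dl ^+ 2 / 8)))) <= 1.
Proof.
have pa4 : 0 <= a ^+ 4 by rewrite exprn_ge0.
have pa5 : 0 <= a ^+ 5 by rewrite exprn_ge0.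
have pN2 : 0 <= 2 * N%:R + 1 :> R by rewrite addr_ge0// mulr_ge0.
have N2 : 2 * N%:R + 1 <= expR (102 * a).
  have -> : 102 * a = 101 * a + a by ring.
  apply: add_expR_le => //.
    have -> : 101 * a = a + 100 * a by ring.
    by apply: mul_expR_le => //; apply: c_exp; lra.
  by apply: le_trans (expR_ge1Dx _); rewrite lerDl mulr_ge0.
have t1 : (2 * N%:R + 1) ^+ (4 * blocks) <= expR (408 * a ^+ 5).
  apply: le_trans (exprn_expR_le (4 * blocks) pN2 N2) _.
  by rewrite natrM qE ler_expR le_eqVlt; apply/orP; left; apply/eqP; ring.
have t2 : blocks%:R * (2 * N%:R + 1) ^+ (4 * blocks) <= expR (205 * a + 408 * a ^+ 5).
  rewrite qE; apply: le_trans (mul_expR_le pa4 _ a4_exp t1) _; first by rewrite exprn_ge0.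
  by rewrite ler_expR; move: a0; lra.
have t3 : 2 * (blocks%:R * N%:R ^+ 2) <= expR (205 * a + 408 * a ^+ 5).
  have u1 := exprn_expR_le 2 N_ge0 N_exp.
  have u2 := mul_expR_le pa4 (exprn_ge0 2 N_ge0) a4_exp u1.
  have u3 : 2 <= expR a by apply: c_exp; lra.
  have u4 := mul_expR_le (ler0n _ 2) (mulr_ge0 pa4 (exprn_ge0 2 N_ge0)) u3 u2.
  rewrite qE; apply: le_trans u4 _; rewrite ler_expR; move: a0 pa5; lra.
have p205 : 0 <= 205 * a + 408 * a ^+ 5 by apply: addr_ge0; apply: mulr_ge0; rewrite ?ler0n.
have t4 := add_expR_le p205 a1 t3 t2.
have pe : 0 <= 2 * expR (- (dl ^+ 2 / 8)) by rewrite mulr_ge0 ?expR_ge0.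
have ps : 0 <= (1 + rho * N%:R ^+ 2) ^+ blocks by rewrite exprn_ge0.
have p4 : 0 <= 2 * (blocks%:R * N%:R ^+ 2) + blocks%:R * (2 * N%:R + 1) ^+ (4 * blocks) :> R.
  by rewrite addr_ge0 ?mulr_ge0 ?exprn_ge0 ?ler0n.
have t5 := mul_expR_le p4 pe t4 eps_exp.
have t6 := mul_expR_le ps (mulr_ge0 p4 pe) supq_exp t5.
apply: le_trans t6 _; rewrite -[leRHS]expR0 ler_expR.
have := @final_num 510 207; lra.
Qed.

Lemma mean_norm_Psi_params (f : 'I_N -> 'I_N -> 'I_N -> cube N -> R) :
  haar_family f ->
  mean (fun w => `|Psi f rho width blocks finset.set0 finset.set0 w|) <= 2 * expR 1 ^+ 2 + 1.
Proof.
move=> hf.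
apply: (@mean_norm_Psi_le R n f hf rho width blocks lam dl scale) => //.
- by rewrite divr_gt0.
- by rewrite divr_gt0// exprn_gt0.
- rewrite ler_pdivrMr// mul1r; apply: le_trans as50; exact: apow.
- by rewrite exprn_ege1.
- exact: remainder_small_ok.
- rewrite expn_gt0 m0/=; apply: leq_trans mN; by rewrite leq_pexp2l.
- apply: le_trans width_ge; rewrite ler_pdivlMr ?exprn_gt0// /dl.
  apply: le_trans aN; have -> : 12 * (a ^+ 3) ^+ 4 * a ^+ 4 = 12 * a ^+ 16 by ring.
  rewrite [leRHS](exprD _ 84 16) ler_wpM2r ?exprn_ge0//.
  by apply: le_trans (_ : a <= _); [apply: a_num; lra|rewrite ler_eXnr].
- have -> : Num.sqrt scale%:R = a ^+ 16 :> R.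
    rewrite /scale natrX (exprM _ 16 2) sqrtr_sqr ger0_norm// exprn_ge0//.
  rewrite /dl -exprM [leRHS](exprD _ 1 15) ler_wpM2r ?exprn_ge0// expr1.
  apply: a_num; lra.
- apply: le_trans aN; rewrite /dl natrX.
  have -> : 6 * (a ^+ 32) ^+ 2 * (a ^+ 3) ^+ 2 = 6 * a ^+ 70 by ring.
  rewrite [leRHS](exprD _ 30 70) ler_wpM2r ?exprn_ge0//.
  by apply: le_trans (_ : a <= _); [apply: a_num; lra|rewrite ler_eXnr].
- exact: tail_small_ok.
- exact: exceptional_small_ok.
- exact: bad_small_ok.
Qed.

End NumericChoice.

(** * Haar sums as functions of the digits *)

Section Prefix.
Variables (R : realType) (n : nat).
Local Notation N := n.+1.
Implicit Types (w : cube N) (c : 'I_3) (k : nat).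

Definition digit c k w : bool := w (c, inord k).

Fixpoint prefix c k w : nat :=
  if k is k'.+1 then ((prefix c k' w).*2 + digit c k' w)%N else 0.

Lemma prefix_lt c k w : (prefix c k w < 2 ^ k)%N.
Proof.
elim: k => [//|k IH] /=; rewrite expnS mul2n.
by case: (digit c k w); rewrite ?addn1 ?addn0 ?ltn_double// -doubleS leq_double.
Qed.

Lemma digit_flip c c' k (j : 'I_N) w : (k < N)%N ->
  digit c k (flip (c', j) w) = (if (c == c') && (k == j) then ~~ digit c k w else digit c k w).
Proof.
by move=> kN; rewrite /digit ffunE xpair_eqE -(inj_eq val_inj (inord k))/= inordK.
Qed.

Lemma prefix_flip c c' k (j : 'I_N) w : (k <= N)%N -> (c != c') || (k <= j)%N ->
  prefix c k (flip (c', j) w) = prefix c k w.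
Proof.
elim: k => [//|k IH] kN h /=; rewrite IH ?(ltnW kN)//; last first.
  by case/orP: h => [->//|/ltnW->]; rewrite orbT.
rewrite digit_flip//; case: ifP => // /andP[/eqP cc /eqP kj].
by move: h; rewrite cc kj eqxx ltnn.
Qed.

(** The first [k] digits are uniform on [2 ^ k] values and independent of the other coordinates, the
    only ones on which [phi p] depends. *)
Lemma mean_prefix (phi : nat -> cube N -> R) c k : (k <= N)%N ->
  (forall p, inv c 0 (phi p)) ->
  mean (fun w => phi (prefix c k w) w) = 2 ^- k * \sum_(p < 2 ^ k) mean (phi p).
Proof.
elim: k phi => [|k IH] phi kN hphi.
  by rewrite expn0 big_ord1 expr0 invr1 mul1r.
pose psi p w := 2^-1 * (phi p.*2 w + phi (p.*2 + 1)%N w).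
have -> : mean (fun w => phi (prefix c k.+1 w) w) = mean (fun w => psi (prefix c k w) w).
  rewrite (mean_sym (c, Ordinal kN)); apply: eq_mean => w.
  rewrite hphi// /psi /= digit_flip// !eqxx/= prefix_flip ?(ltnW kN) ?leqnn ?orbT//.
  by case: (digit c k w); rewrite ?addn0//= addrC.
rewrite IH ?(ltnW kN)//; last first.
  by move=> p j w _; rewrite /psi !hphi.
rewrite exprS invfM -mulrA mulrCA; congr (_ * _).
have -> : \sum_(p < 2 ^ k) mean (psi p) =
    2^-1 * \sum_(p < 2 ^ k) (mean (phi p.*2) + mean (phi (p.*2 + 1)%N)).
  by rewrite mulr_sumr; apply: eq_bigr => p _; rewrite meanZ meanD.
congr (_ * _); rewrite expnS mul2n.
rewrite -!(big_mkord xpredT (fun p => mean (phi p))).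
rewrite -(big_mkord xpredT (fun p => mean (phi p.*2) + mean (phi (p.*2 + 1)%N))).
elim: (2 ^ k)%N => [|m IHm]; first by rewrite !big_nil.
by rewrite doubleS !big_nat_recr//= IHm addn1 addrA.
Qed.

Definition dy k (p : 'I_(2 ^ k)) : dyadic := Tagged (fun k => 'I_(2 ^ k)) p.
Definition pre c k w : 'I_(2 ^ k) := Ordinal (prefix_lt c k w).
Definition sg (b : bool) : R := if b then 1 else -1.

(** The value at the digits [w] of the sum of [beta R * h_R] over the [R] of sides [2 ^- i],
    [2 ^- j], [2 ^- k]: only the [R] containing the point contributes, with the sign read off from
    the next digit of each coordinate. *)
Definition component (beta : dyadic_rect -> R) (i j k : 'I_N) w : R :=
  if (i + j + k == n)%N then
    beta (dy (pre c0 i w), dy (pre c1 j w), dy (pre c2 k w)) *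
    (sg (digit c0 i w) * sg (digit c1 j w) * sg (digit c2 k w))
  else 0.

Lemma pre_flip c c' k (j : 'I_N) w : (k <= N)%N -> (c != c') || (k <= j)%N ->
  pre c k (flip (c', j) w) = pre c k w.
Proof. by move=> kN h; apply/val_inj; rewrite /= prefix_flip. Qed.

Lemma sgN b : sg (~~ b) = - sg b.
Proof. by case: b; rewrite /sg/= ?opprK. Qed.

Lemma component_fresh beta (i j k : 'I_N) : fresh3 i j k (component beta i j k).
Proof.
have [h|h] := boolP (i + j + k == n)%N; last first.
  by split; apply: (eq_fresh _ (fresh0 _ _ _)) => w; rewrite /component (negbTE h).
have lt (x : 'I_N) : (x <= N)%N by apply: ltnW.
split; split => [w|l w il]; rewrite /component h.
- rewrite !pre_flip ?lt ?leqnn ?orbT// !digit_flip// !eqxx/= sgN; ring.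
- rewrite !pre_flip ?lt ?(ltnW il) ?orbT// !digit_flip//.
  by rewrite /= ltn_eqF.
- rewrite !pre_flip ?lt ?leqnn ?orbT// !digit_flip// !eqxx/= sgN; ring.
- rewrite !pre_flip ?lt ?(ltnW il) ?orbT// !digit_flip//.
  by rewrite /= ltn_eqF.
- rewrite !pre_flip ?lt ?leqnn ?orbT// !digit_flip// !eqxx/= sgN; ring.
- rewrite !pre_flip ?lt ?(ltnW il) ?orbT// !digit_flip//.
  by rewrite /= ltn_eqF.
Qed.

Lemma component_supp beta (i j k : 'I_N) w : component beta i j k w != 0 -> (i + j + k = n)%N.
Proof. by rewrite /component; case: ifP => [/eqP//|_]; rewrite eqxx. Qed.

Lemma norm_sg b : `|sg b| = 1. Proof. by case: b; rewrite /sg ?normrN normr1. Qed.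

Lemma sg_sqr b : sg b * sg b = 1. Proof. by case: b; rewrite /sg ?mulrNN mulr1. Qed.

Lemma norm_component beta (i j k : 'I_N) w : `|component beta i j k w| =
  if (i + j + k == n)%N then
    `|beta (dy (pre c0 i w), dy (pre c1 j w), dy (pre c2 k w))| else 0.
Proof.
rewrite /component; case: ifP => _; last exact: normr0.
by rewrite !normrM !norm_sg !mulr1.
Qed.

Definition sign_of (alpha : dyadic_rect -> R) r : R := if 0 <= alpha r then 1 else -1.

Lemma sign_family alpha : haar_family (component (sign_of alpha)).
Proof.
split.
- exact: component_supp.
- move=> i j k w; rewrite norm_component; case: ifP => // _.
  by rewrite /sign_of; case: ifP; rewrite ?normrN normr1.
- by move=> i j k; case: (component_fresh (sign_of alpha) i j k).
- by move=> i j k; case: (component_fresh (sign_of alpha) i j k).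
- by move=> i j k; case: (component_fresh (sign_of alpha) i j k).
Qed.

Lemma sign_component alpha (i j k : 'I_N) w :
  component (sign_of alpha) i j k w * component alpha i j k w = `|component alpha i j k w|.
Proof.
rewrite norm_component /component; case: ifP => _; last by rewrite mul0r.
set a := alpha _; set s0 := sg _; set s1 := sg _; set s2 := sg _.
have -> : sign_of alpha (dy (pre c0 i w), dy (pre c1 j w), dy (pre c2 k w)) *
   (s0 * s1 * s2) * (a * (s0 * s1 * s2)) =
  (sign_of alpha (dy (pre c0 i w), dy (pre c1 j w), dy (pre c2 k w)) * a) *
   ((s0 * s0) * (s1 * s1) * (s2 * s2)) by ring.
rewrite !sg_sqr !mulr1 /sign_of -/a; case: ifPn => a0.
  by rewrite mul1r ger0_norm.
by rewrite mulN1r ltr0_norm// ltNge.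
Qed.

(** Rectangles of fixed sides tile the cube, and each is hit with probability [2 ^- n]. *)
Lemma mean_norm_component beta (i j k : 'I_N) :
  mean (fun w => `|component beta i j k w|) =
  if (i + j + k == n)%N then 2 ^- n *
    \sum_(p < 2 ^ i) \sum_(p' < 2 ^ j) \sum_(p'' < 2 ^ k) `|beta (dy p, dy p', dy p'')|
  else 0.
Proof.
case: (boolP (i + j + k == n)%N) => h; last first.
  by rewrite -[RHS](@mean_cst R N 0); apply: eq_mean => w; rewrite norm_component (negbTE h).
have p2 m : (0 < 2 ^ m)%N by rewrite expn_gt0.
(* Reduction modulo [2 ^ m] makes every natural number an index, as [mean_prefix] asks for functions
   on all of them. *)
pose md (m p : nat) : 'I_(2 ^ m) := Ordinal (ltn_pmod p (p2 m)).
have mdE (m : nat) (p : 'I_(2 ^ m)) : md m p = p by apply/val_inj; rewrite /= modn_small.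
have preE c m w : pre c m w = md m (prefix c m w) by rewrite -[LHS]mdE.
have lt (x : 'I_N) : (x <= N)%N by apply: ltnW.
have -> : mean (fun w => `|component beta i j k w|) = mean (fun w =>
   `|beta (dy (md i (prefix c0 i w)), dy (md j (prefix c1 j w)), dy (md k (prefix c2 k w)))|).
  by apply: eq_mean => w; rewrite norm_component h !preE.
rewrite (@mean_prefix (fun p w =>
   `|beta (dy (md i p), dy (md j (prefix c1 j w)), dy (md k (prefix c2 k w)))|))//; last first.
  by move=> p l w _; rewrite !prefix_flip.
have -> : 2 ^- n = 2 ^- i * (2 ^- j * 2 ^- k) :> R.
  by rewrite -!invfM -!exprD addnA (eqP h).
rewrite -!mulrA; congr (_ * _).
rewrite mulrA mulr_sumr; apply: eq_bigr => p _.
rewrite (@mean_prefix (fun p' w =>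
   `|beta (dy (md i p), dy (md j p'), dy (md k (prefix c2 k w)))|))//; last first.
  by move=> p' l w _; rewrite !prefix_flip.
rewrite -mulrA; congr (_ * _); rewrite mulr_sumr; apply: eq_bigr => p' _.
rewrite (@mean_prefix (fun p'' w =>
   `|beta (dy (md i p), dy (md j p'), dy (md k p''))|))//.
congr (_ * _); apply: eq_bigr => p'' _.
by rewrite mean_cst !mdE.
Qed.

End Prefix.

(** * Dyadic intervals of the line *)

Section Reals.
Variables (R : realType) (n : nat).
Local Notation N := n.+1.
Implicit Types (w : cube N) (c : 'I_3).

Local Notation level := {i : 'I_N & 'I_(2 ^ i)}.

Let emb (t : level) : dyadic := dy (tagged t).

Let emb_inj : injective emb.
Proof.
move=> [i p] [i' p'] e.
pose dval (d : dyadic) : nat * nat := (tag d, nat_of_ord (tagged d)).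
have := congr1 dval e; rewrite /dval /emb/= => -[/val_inj ii].
move: p p' e; rewrite ii => p p' _ /val_inj pp.
by rewrite pp.
Qed.

(** The levels of a rectangle of volume [2 ^- n] are at most [n], so the set is the image of a
    finite type and the finitely supported sum becomes an ordinary one. *)
Lemma sum_dyadic_rects (F : dyadic_rect -> R) :
  \sum_(r \in dyadic_rects R n) F r =
  \sum_(i < N) \sum_(j < N) \sum_(k < N) if (i + j + k == n)%N then
    \sum_(p < 2 ^ i) \sum_(p' < 2 ^ j) \sum_(p'' < 2 ^ k) F (dy p, dy p', dy p'')
  else 0.
Proof.
pose P : pred (level * level * level) :=
  fun t => (tag t.1.1 + tag t.1.2 + tag t.2 == n)%N.
pose h (t : level * level * level) : dyadic_rect := (emb t.1.1, emb t.1.2, emb t.2).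
have bij : set_bij [set` P] (dyadic_rects R n) h.
  rewrite dyadic_rectsE; split.
  - by move=> t /= /eqP.
  - move=> [[t1 t2] t3] [[u1 u2] u3] _ _ e.
    have e1 : t1 = u1 := emb_inj (congr1 (fun r : dyadic_rect => r.1.1) e).
    have e2 : t2 = u2 := emb_inj (congr1 (fun r : dyadic_rect => r.1.2) e).
    have e3 : t3 = u3 := emb_inj (congr1 (fun r : dyadic_rect => r.2) e).
    by rewrite e1 e2 e3.
  - move=> [[[i p] [j p']] [k p'']] /= e.
    have ni : (i < N)%N by lia.
    have nj : (j < N)%N by lia.
    have nk : (k < N)%N by lia.
    exists (Tagged (fun i : 'I_N => 'I_(2 ^ i)) (p : 'I_(2 ^ Ordinal ni)),
            Tagged (fun i : 'I_N => 'I_(2 ^ i)) (p' : 'I_(2 ^ Ordinal nj)),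
            Tagged (fun i : 'I_N => 'I_(2 ^ i)) (p'' : 'I_(2 ^ Ordinal nk))) => //.
    by apply/eqP; exact: e.
rewrite (@reindex_fsbig _ _ _ _ _ h [set` P] _ _ bij) -(@bigfs _ _ _ _ (index_enum _) P) ?index_enum_uniq//; last first.
  by move=> t _; rewrite mem_index_enum.
rewrite big_mkcond/=.
rewrite -(pair_bigA _ (fun (u : level * level) (t : level) =>
  if P (u, t) then F (h (u, t)) else 0))/=.
rewrite -(pair_bigA _ (fun (u v : level) =>
  \sum_t if P (u, v, t) then F (h (u, v, t)) else 0))/=.
have sigE (G : level -> R) : \sum_t G t =
    \sum_(i < N) \sum_(p < 2 ^ i) G (Tagged (fun i : 'I_N => 'I_(2 ^ i)) p).
  rewrite (sig_big_dep (fun _ => true) (fun _ _ => true)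
    (fun (i : 'I_N) (p : 'I_(2 ^ i)) => G (Tagged (fun i : 'I_N => 'I_(2 ^ i)) p)))/=.
  by apply: eq_bigr => -[].
rewrite sigE; apply: eq_bigr => i _.
pose T (i : 'I_N) (p : 'I_(2 ^ i)) : level := Tagged (fun i : 'I_N => 'I_(2 ^ i)) p.
transitivity (\sum_(p < 2 ^ i) \sum_(j < N) \sum_(p' < 2 ^ j) \sum_(k < N) \sum_(p'' < 2 ^ k)
   if P (T i p, T j p', T k p'') then F (h (T i p, T j p', T k p'')) else 0).
  apply: eq_bigr => p _; rewrite sigE; apply: eq_bigr => j _; apply: eq_bigr => p' _.
  exact: sigE.
rewrite exchange_big; apply: eq_bigr => j _ /=.
under eq_bigr do rewrite exchange_big/=.
rewrite exchange_big; apply: eq_bigr => k _ /=.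
rewrite /P /h /emb /=; case: ifP => _ //.
by rewrite big1// => p _; rewrite big1// => p' _; rewrite big1.
Qed.

Let lo (k p : nat) : R := p%:R * 2 ^- k.
Let hi (k p : nat) : R := p.+1%:R * 2 ^- k.

Let two_pos k : 0 < 2 ^- k :> R. Proof. by rewrite invr_gt0 exprn_gt0. Qed.

Let half_scale k : 2 ^- k = 2 * 2 ^- k.+1 :> R.
Proof. by rewrite exprS invfM mulrA divff ?mul1r. Qed.

Let nested (k p : nat) (b : bool) x :
  lo k.+1 (p.*2 + b) <= x < hi k.+1 (p.*2 + b) -> lo k p <= x < hi k p.
Proof.
rewrite /lo /hi (half_scale k) => /andP[h1 h2]; have s0 := two_pos k.+1.
have e (y : nat) : y%:R * (2 * 2 ^- k.+1) = y.*2%:R * 2 ^- k.+1 :> R.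
  by rewrite mulrA -natrM muln2.
rewrite !e; apply/andP; split.
  by apply: le_trans h1; rewrite ler_pM2r// ler_nat leq_addr.
by apply: lt_le_trans h2 _; rewrite ler_pM2r// ler_nat; clear; case: b; rewrite /=; lia.
Qed.

Lemma prefix_nested c w (k : nat) x : (k <= N)%N ->
  lo N (prefix c N w) <= x < hi N (prefix c N w) ->
  lo k (prefix c k w) <= x < hi k (prefix c k w).
Proof.
move=> kN hN; rewrite -(subKn kN); elim: (N - k)%N => [|m IH]; first by rewrite subn0.
have [mN|mN] := ltnP m N; last first.
  have -> : (N - m.+1 = N - m)%N by lia.
  exact: IH.
move: IH; have -> : (N - m = (N - m.+1).+1)%N by lia.
exact: nested.
Qed.

Let index_unique (k p p' : nat) x : lo k p <= x < hi k p -> lo k p' <= x < hi k p' -> p = p'.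
Proof.
have s0 := two_pos k.
move=> /andP[h1 h2] /andP[h3 h4].
have := le_lt_trans h1 h4; have := le_lt_trans h3 h2.
rewrite /lo /hi !ltr_pM2r// !ltr_nat; lia.
Qed.

(** A point of the interval of length [2 ^- N] has [w] as its first digits: the first [k] name the
    interval of level [k] around it, and the next one tells the half, 1 being the right. *)
Lemma haar_prefix c w (k : 'I_N) (p : 'I_(2 ^ k)) x :
  lo N (prefix c N w) <= x < hi N (prefix c N w) ->
  haar (dy p) x = if p == pre c k w then sg R (digit c k w) else 0.
Proof.
move=> hx.
have xk := prefix_nested (ltnW (ltn_ord k)) hx.
have xk1 := prefix_nested (ltn_ord k : (k.+1 <= N)%N) hx.
have midE : dyadic_mid R (dy p) = (p.*2 + 1)%:R * 2 ^- k.+1.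
  rewrite /dyadic_mid /dyadic_lo /dyadic_hi /= (half_scale k).
  have -> : (p.*2 + 1)%:R = p%:R + p.+1%:R :> R by rewrite -natrD; congr _%:R; lia.
  by move: (2 ^- k.+1) => t; field.
have loE : dyadic_lo R (dy p) = lo k p by [].
have hiE : dyadic_hi R (dy p) = hi k p by [].
have lo1 : lo k p = lo k.+1 p.*2 by rewrite /lo (half_scale k) mulrA -natrM muln2.
have hi1 : hi k p = hi k.+1 (p.*2 + 1).
  by rewrite /hi (half_scale k) mulrA -natrM muln2 addn1 doubleS.
pose M := (p.*2 + 1)%:R * 2 ^- k.+1 : R.
have lom : lo k.+1 (p.*2 + 1) = M by [].
have him : hi k.+1 p.*2 = M by rewrite /hi -addn1.
have step (y : nat) : lo k.+1 y <= hi k.+1 y by rewrite /lo /hi ler_pM2r// ler_nat.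
have m1 : lo k.+1 p.*2 <= M by rewrite -him step.
have m2 : M <= hi k.+1 (p.*2 + 1) by rewrite -lom step.
rewrite /haar !indicE !mem_setE !in_itv/= midE loE hiE lo1 hi1 -/M.
case: eqP => [pE|pne].
  move: xk1; rewrite /= -[prefix c k w]/(nat_of_ord (pre c k w)) -pE.
  case: (digit c k w) => /= /andP[h1 h2].
    by rewrite lom in h1; rewrite h1 h2 [x < M]ltNge h1 andbF oppr0 add0r.
  rewrite addn0 in h1 h2; rewrite him in h2.
  by rewrite h1 h2 [M <= x]leNgt h2 addr0.
have no : ~~ (lo k.+1 p.*2 <= x < hi k.+1 (p.*2 + 1)).
  rewrite -lo1 -hi1; apply/negP => h; apply: pne; apply/val_inj.
  exact: index_unique h xk.
have -> : (lo k.+1 p.*2 <= x < M) = false.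
  by apply/negP => /andP[h1 h2]; move/negP: no; apply; rewrite h1 (lt_le_trans h2 m2).
have -> : (M <= x < hi k.+1 (p.*2 + 1)) = false.
  by apply/negP => /andP[h1 h2]; move/negP: no; apply; rewrite h2 (le_trans m1 h1).
by rewrite oppr0 addr0.
Qed.

End Reals.

Local Open Scope classical_set_scope.

(** * The passage to the essential supremum *)

Section EssentialSupremum.
Variables (R : realType) (n : nat).
Local Notation N := n.+1.
Implicit Types (w : cube N) (alpha : dyadic_rect -> R).

Definition haar_sum alpha (x : R3 R) : R :=
  \sum_(r \in dyadic_rects R n) alpha r * haar_rect r x.

(** Its sides [2 ^- n.+1] are at most half of those of any [R] of volume [2 ^- n], so every such
    [h_R] is constant on it. *)
Definition cell w : dyadic_rect :=
  (dy (pre c0 N w), dy (pre c1 N w), dy (pre c2 N w)).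

Lemma dyadic_itvP (I : dyadic) y :
  Defs.dyadic_itv R I y -> dyadic_lo R I <= y < dyadic_hi R I.
Proof. by rewrite /Defs.dyadic_itv/= in_itv. Qed.

Lemma haar_sum_cell alpha w x : dyadic_box R (cell w) x ->
  haar_sum alpha x = \sum_i \sum_j \sum_k component alpha i j k w.
Proof.
case=> -[] /dyadic_itvP x0 /dyadic_itvP x1 /dyadic_itvP x2.
rewrite /haar_sum sum_dyadic_rects.
apply: eq_bigr => i _; apply: eq_bigr => j _; apply: eq_bigr => k _.
rewrite /component; case: ifP => // _.
have h0 := haar_prefix _ x0; have h1 := haar_prefix _ x1; have h2 := haar_prefix _ x2.
rewrite (bigD1 (pre c0 i w))//= [X in _ + X]big1 ?addr0; last first.
  move=> p /negbTE pn; rewrite big1// => p' _; rewrite big1// => p'' _.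
  by rewrite /haar_rect /= h0 pn !mul0r mulr0.
rewrite (bigD1 (pre c1 j w))//= [X in _ + X]big1 ?addr0; last first.
  move=> p' /negbTE pn; rewrite big1// => p'' _.
  by rewrite /haar_rect /= h1 pn mulr0 mul0r mulr0.
rewrite (bigD1 (pre c2 k w))//= [X in _ + X]big1 ?addr0; last first.
  by move=> p'' /negbTE pn; rewrite /haar_rect /= h2 pn mulr0 mulr0.
by rewrite /haar_rect /= h0 h1 h2 !eqxx.
Qed.

Lemma dyadic_itv_sub (I : dyadic) : Defs.dyadic_itv R I `<=` `[0, 1].
Proof.
case: I => k p x /dyadic_itvP; rewrite /dyadic_lo /dyadic_hi /= => /andP[h1 h2].
rewrite /= in_itv/=; apply/andP; split; first by apply: le_trans h1; rewrite mulr_ge0// invr_ge0 exprn_ge0.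
apply: (le_trans (ltW h2)); rewrite ler_pdivrMr ?exprn_gt0// mul1r -natrX ler_nat.
exact: ltn_ord.
Qed.

Lemma measurable_dyadic_box r : measurable (dyadic_box R r).
Proof.
by apply: measurableX; [apply: measurableX|]; exact: measurable_itv.
Qed.

Lemma cell_measure_gt0 w : (0 < unit_cube_measure R (dyadic_box R (cell w)))%E.
Proof.
have -> : unit_cube_measure R (dyadic_box R (cell w)) =
    lebesgue_measure3 R (dyadic_box R (cell w)).
  rewrite /unit_cube_measure /mrestr/=; congr (lebesgue_measure3 R _).
  apply/setIidPl => x [[h0 h1] h2].
  by split; [split|]; apply: dyadic_itv_sub; eassumption.
have : dyadic_rects R (N + N + N) (cell w) by rewrite dyadic_rectsE.
by rewrite /dyadic_rects/= => ->; rewrite lte_fin invr_gt0 exprn_gt0.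
Qed.

(** If the essential supremum were smaller, the whole cell, where the sum is constant, would lie in
    a null set. *)
Lemma haar_sum_le_Lnorm alpha w :
  (`|\sum_i \sum_j \sum_k component alpha i j k w|%:E <=
   'N[unit_cube_measure R]_+oo[(fun x => (haar_sum alpha x)%:E)])%E.
Proof.
set mu := unit_cube_measure R; set B := dyadic_box R (cell w).
have mB : measurable B by exact: measurable_dyadic_box.
have B0 : (0 < mu B)%E by exact: cell_measure_gt0.
have T0 : (0 < mu setT)%E.
  by apply: lt_le_trans B0 _; apply: le_measure; rewrite ?inE//.
rewrite Lnorm.unlock T0.
have := ess_sup_inf.ess_sup_ge mu (abse \o (fun x => (haar_sum alpha x)%:E)).
set E := ess_sup_inf.ess_sup _ _ => -[A [mA A0 AE]].
rewrite leNgt; apply/negP => h.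
have BA : B `<=` A.
  move=> x Bx; apply: AE => /= xE; move: h; rewrite ltNge => /negP; apply.
  by rewrite -(haar_sum_cell alpha Bx).
have : (mu B <= mu A)%E by apply: le_measure; rewrite ?inE.
by rewrite A0 leNgt B0.
Qed.

End EssentialSupremum.

(** * The inequality for large and for bounded [n] *)

Lemma exists_root (k N : nat) : (0 < k)%N -> (0 < N)%N ->
  exists m : nat, (m ^ k <= N)%N /\ (N <= m.+1 ^ k)%N.
Proof.
move=> k0 N0; pose P m := (m ^ k <= N)%N.
have exP : exists m, P m by exists 0; rewrite /P exp0n.
have ubP m : P m -> (m <= N)%N.
  by apply: leq_trans; case: m => // m; rewrite -{1}(expn1 m.+1) leq_pexp2l.
case: (ex_maxnP exP ubP) => m Pm maxm; exists m; split => //.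
by rewrite leqNgt; apply/negP => /ltnW/maxm; rewrite ltnn.
Qed.

(** With [m] about the 100th root of [N], duality with [rho = m / N] gives the power [1 - 1/100] if
    [m] is large. Otherwise [N] is at most [B ^+ 100], and the second summand of the constant
    suffices. *)
Lemma small_ball_finite (R : realType) (n : nat) (alpha : dyadic_rect -> R) (s B : R) :
  1000 * 1000 + 1 <= B -> (1 <= n)%N -> 0 <= s ->
  (forall w : cube n.+1, `|\sum_i \sum_j \sum_k component alpha i j k w| <= s) ->
  2 ^- n * \sum_(r \in dyadic_rects R n) `|alpha r| <=
  (4 * (2 * expR 1 ^+ 2 + 1) + 2 * B ^+ 200) *
    n%:R `^ (1 - 1 / 100) * s.
Proof.
move=> hB n1 s0 hs; set N := n.+1.
have B0 : 0 <= B by apply: le_trans hB; lra.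
have B200 : 0 <= B ^+ 200 := exprn_ge0 200 B0.
have n0 : 0 < n%:R :> R by rewrite ltr0n.
have N0 : 0 < N%:R :> R by rewrite ltr0n.
have -> : 2 ^- n * \sum_(r \in dyadic_rects R n) `|alpha r| =
    \sum_i \sum_j \sum_k mean (fun w => `|component (n := n) alpha i j k w|).
  rewrite sum_dyadic_rects mulr_sumr; apply: eq_bigr => i _.
  rewrite mulr_sumr; apply: eq_bigr => j _; rewrite mulr_sumr; apply: eq_bigr => k _.
  by rewrite mean_norm_component; case: ifP => _; rewrite ?mulr0.
have hf := @sign_family R n alpha.
have dual rho bw q K : (0 < bw)%N -> (N <= q * bw)%N ->
    mean (fun w : cube n.+1 => `|Psi (component (sign_of alpha)) rho bw q finset.set0 finset.set0 w|) <= K ->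
    rho * \sum_i \sum_j \sum_k mean (fun w => `|component (n := n) alpha i j k w|) <= K * s.
  move=> b0 qb hK; apply: (@small_ball_duality R n _ hf rho bw q b0 qb (component alpha) _ _ K s s0 _ hK hs).
  - exact: component_supp.
  - by move=> i j k; apply: component_fresh.
  - exact: sign_component.
move: dual; set T := \sum_i _ => dual.
have np1 : 1 <= n%:R `^ (1 - 1 / 100) :> R.
  apply: (@le_trans _ _ (1 `^ (1 - 1 / 100))); first by rewrite powR1.
  by rewrite ge0_ler_powR ?nnegrE ?ler1n//; lra.
have e2 : 0 <= 2 * expR 1 ^+ 2 + 1 :> R by rewrite addr_ge0 ?mulr_ge0 ?exprn_ge0 ?expR_ge0.
have [m [mN Nm]] := @exists_root 100 N isT isT.
have [m_big|m_small] := leP (1000 * 1000) (m%:R : R).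
  have m0 : 0 < m%:R :> R by apply: lt_le_trans m_big; lra.
  have m1 : 1 <= m%:R :> R by apply: le_trans m_big; lra.
  have := dual _ _ _ _ _ _ (mean_norm_Psi_params m_big mN Nm hf).
  rewrite /rho => /(_ isT (@blocks_width R n m m_big)).
  rewrite -ler_pdivlMl; last by rewrite divr_gt0.
  move=> /le_trans; apply; rewrite invf_div mulrA ler_wpM2r// mulrC.
  have m20 : 0 <= 2 * m%:R :> R by rewrite mulr_ge0// ltW.
  have nm : n%:R `^ (1 / 100) <= 2 * m%:R :> R.
    have -> : 2 * m%:R = ((2 * m%:R) ^+ 100) `^ (1 / 100) :> R.
      rewrite -powR_mulrn// -powRrM (_ : 100%:R * (1 / 100) = 1) ?powRr1//.
      by rewrite mul1r divff// pnatr_eq0.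
    rewrite ge0_ler_powR ?nnegrE ?(exprn_ge0 100 m20) ?(ltW n0)//.
    apply: (@le_trans _ _ (m.+1%:R ^+ 100)).
      by rewrite -natrX ler_nat; apply: leq_trans Nm.
    by rewrite lerXn2r ?nnegrE// -natr1; lra.
  have nE : n%:R = n%:R `^ (1 - 1 / 100) * n%:R `^ (1 / 100) :> R.
    by rewrite -powRD ?subrK ?powRr1 ?(ltW n0)// gt_eqF ?implybT.
  have Nn : N%:R <= 2 * n%:R :> R 
    by rewrite -natrM ler_nat mul2n -addnn; exact: (leq_add n1 (leqnn n)).
  (* One factor 2 is from [N <= 2 * n], the other from [m.+1 <= 2 * m]. *)
  have h : N%:R / m%:R <= 4 * n%:R `^ (1 - 1 / 100) :> R.
    rewrite ler_pdivrMr//; apply: (le_trans Nn); rewrite [in leLHS]nE.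
    rewrite [leRHS](_ : _ = 2 * (n%:R `^ (1 - 1 / 100) * (2 * m%:R))); last by ring.
    by rewrite ler_wpM2l// ler_wpM2l ?powR_ge0.
  apply: le_trans (ler_wpM2l e2 h) _.
  rewrite mulrA [_ * 4]mulrC; apply: ler_wpM2r; first exact: powR_ge0.
  by rewrite lerDl; apply: mulr_ge0.
have bN : N%:R <= B ^+ 100 :> R.
  apply: (@le_trans _ _ (m.+1%:R ^+ 100)); first by rewrite -natrX ler_nat.
  rewrite lerXn2r ?nnegrE// -natr1; apply: le_trans hB.
  by rewrite lerD2r ltW.
(* For bounded [n], a single block with [rho = N ^- 2] is enough. *)
have Psi_le (w : cube n.+1) : `|Psi (component (sign_of alpha)) (N%:R ^- 2) N 1 finset.set0 finset.set0 w| <= 2 :> R.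
  have r0 : 0 <= N%:R ^- 2 :> R by rewrite invr_ge0 exprn_ge0// ltW.
  apply: le_trans (Psi_sup hf N r0 _ _ _ _) _.
  by rewrite expr1 mulVf ?expf_neq0 ?gt_eqF.
have := dual (N%:R ^- 2) N 1%N 2 isT; rewrite mul1n => /(_ (leqnn _)).
have mP : mean (fun w : cube n.+1 => `|Psi (component (sign_of alpha)) (N%:R ^- 2) N 1
    finset.set0 finset.set0 w|) <= 2 :> R.
  by rewrite -[leRHS](@mean_cst R N 2); apply: ler_mean.
move=> /(_ mP); rewrite -ler_pdivlMl ?invr_gt0 ?exprn_gt0// invrK => /le_trans; apply.
rewrite mulrA ler_wpM2r//.
have N2 : N%:R ^+ 2 <= B ^+ 200 :> R.
  by rewrite (exprM _ 100 2) lerXn2r ?nnegrE ?(exprn_ge0 100 B0)// ltW.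
apply: (@le_trans _ _ (2 * B ^+ 200)); first by rewrite mulrC ler_wpM2l.
apply: (@le_trans _ _ (4 * (2 * expR 1 ^+ 2 + 1) + 2 * B ^+ 200)).
  by rewrite lerDr mulr_ge0.
rewrite ler_peMr//; apply: addr_ge0; exact: mulr_ge0.
Qed.

Theorem theorem1p7 (R : realType) :
  exists eta K : R, [/\ 0 < eta, 0 < K &
    forall (n : nat) (alpha : dyadic_rect -> R), (1 <= n)%N ->
      ((2 ^- n * \sum_(r \in dyadic_rects R n) `|alpha r|)%:E <=
       (K * n%:R `^ (1 - eta))%:E *
       'N[unit_cube_measure R]_+oo
         [(fun x => (\sum_(r \in dyadic_rects R n) alpha r * haar_rect r x)%:E)])%E].
Proof.
have [B hB] : exists B : R, 1000 * 1000 + 1 <= B by exists (1000 * 1000 + 1).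
exists (1 / 100), (4 * (2 * expR 1 ^+ 2 + 1) + 2 * B ^+ 200).
have B0 : 0 <= B by apply: le_trans hB; lra.
have e2 : 0 < 2 * expR 1 ^+ 2 + 1 :> R.
  by rewrite ltr_wpDl// mulr_ge0// exprn_ge0// expR_ge0.
have K0 : 0 < 4 * (2 * expR 1 ^+ 2 + 1) + 2 * B ^+ 200.
  by rewrite ltr_wpDr ?mulr_gt0// mulr_ge0// exprn_ge0.
split=> // n alpha n1.
have Kn0 : 0 < (4 * (2 * expR 1 ^+ 2 + 1) + 2 * B ^+ 200) * n%:R `^ (1 - 1 / 100).
  by rewrite mulr_gt0// powR_gt0// ltr0n.
have := @haar_sum_le_Lnorm R n alpha; rewrite /haar_sum.
set L := ('N[_]_+oo[_])%E => hL.
have L0 : (0 <= L)%E by exact: Lnorm_ge0.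
move: L L0 hL => [s| |] L0 hL //.
  have s0 : 0 <= s by rewrite -lee_fin.
  rewrite -EFinM lee_fin; apply: (small_ball_finite hB n1 s0) => w.
  by have := hL w; rewrite lee_fin.
by rewrite gt0_muley ?lte_fin// leey.
Qed.
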